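(* Let $(\bar{S},\bar{D})$ be an $(N+1)$-dimensional securities market model with gains process $\bar G=\bar S+\bar D$, $d\bar G=\bar\mu\,dt+\bar\sigma\,dW$. Let $\bar b$ be a money market account for $(\bar S,\bar D)$ with value process $M$ and interest rate process $r$, and assume $\bar D\in\mathcal{L}(1/M)$. Then the following statements are equivalent: (1) $(\bar{S},\bar{D})$ is instantaneously arbitrage-free (there exists no zero-value instantaneous arbitrage trading strategy). (2) There exists no instantaneous arbitrage trading strategy. (3) There exists no self-financing instantaneous arbitrage trading strategy. (4) Every instantaneously riskless trading strategy $\bar\Delta$ has zero instantaneous expected excess return almost everywhere, i.e. $\bar\Delta(\bar\mu-r\bar S)=0$ almost everywhere.
   Context: Setting: $(\Omega,\mathcal{F},P)$ is a complete probability space with a filtration $\{\mathcal{F}_t\}_{t\in\mathcal{T}}$, where $\mathcal{T}$ is the time interval ($[0,T]$ or $[0,\infty)$), and $W$ is a $K$-dimensional Wiener process relative to the filtration. ''Measurable'' process means jointly measurable on $\Omega\times\mathcal{T}$; ''almost everywhere'' and ''positive measure'' refer to the product of $P$ and Lebesgue measure on $\Omega\times\mathcal{T}$. $\mathcal{L}^1$ (resp. $\mathcal{L}^2$) is the set of adapted, measurable, pathwise integrable (resp. pathwise square integrable) processes (over each $[0,t]$, $t\in\mathcal T$). Time integrals and stochastic integrals of such processes are understood to be continuous adapted processes, and equality of such processes is up to indistinguishability. Securities market model: a pair $(\bar S,\bar D)$ of adapted measurable $(N+1)$-dimensional (column vector) processes (prices and cumulative dividends) with $\bar D(0)=0$ such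 that $\bar G=\bar S+\bar D$ is an Itô process: $\bar G(t)=\bar G(0)+\int_0^t\bar\mu\,ds+\int_0^t\bar\sigma\,dW$, with $\bar\mu$ an $(N+1)$-dimensional process in $\mathcal{L}^1$ and $\bar\sigma$ an $(N+1)\times K$ matrix-valued process in $\mathcal{L}^2$. A trading strategy is an adapted, measurable $(N+1)$-dimensional row-vector-valued process $\bar\Delta$; its value process is $\bar\Delta\bar S$. $\mathcal{L}(\bar G)$ is the set of trading strategies with $\bar\Delta\bar\mu\in\mathcal{L}^1$, $\bar\Delta\bar\sigma\in\mathcal{L}^2$. A trading strategy $\bar\Delta\in\mathcal{L}(\bar G)$ is self-financing if $\bar\Delta(t)\bar S(t)=\bar\Delta(0)\bar S(0)+\int_0^t\bar\Delta\,d\bar G$ for all $t$. A money market account is a self-financing trading strategy $\bar b$ whose value process $M=\bar b\bar S$ is positive and instantaneously riskless (zero dispersion, i.e. zero $dW$-coefficient). Then $M(t)=M(0)\exp\{\int_0^t r\,ds\}$ for some $r\in\mathcal{L}^1$, the interest rate process. The condition $\bar D\in\mathcal{L}(1/M)$ is equivalent to $\bar D r\in\mathcal{L}^1$. Under it, the gains process in units of the money market account is $\bar G^{1/M}(t)=\bar G(t)/M(t)+\int_0^t\bar D\frac{r}{M}\,ds$, which satisfies $d\bar G^{1/M}=\frac1M(\bar\mu-r\bar S)\,dt+\frac1M\bar\sigma\,dW$; $\mathcal{L}(\bar G^{1/M})$ is the set of trading strategies $\bar\Delta$ with $\frac1M\bar\Delta(\bar\mu-r\bar S)\in\mathcal{L}^1$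 and $\frac1M\bar\Delta\bar\sigma\in\mathcal{L}^2$. A trading strategy $\bar\Delta$ is instantaneously riskless if $\bar\Delta\bar\sigma=0$ almost everywhere. A zero-value instantaneous arbitrage trading strategy is an instantaneously riskless trading strategy $\bar\Delta$ such that $\bar\Delta\bar S=0$ almost everywhere, $\bar\Delta\bar\mu\ge 0$ almost everywhere, and $\bar\Delta\bar\mu>0$ on a set of positive measure. An instantaneous arbitrage trading strategy is an instantaneously riskless trading strategy $\bar\Delta\in\mathcal{L}(\bar G^{1/M})$ such that $\bar\Delta(\bar\mu-r\bar S)\ge 0$ almost everywhere and $\bar\Delta(\bar\mu-r\bar S)>0$ on a set of positive measure. The instantaneous expected excess (dollar) return of a trading strategy $\bar\Delta$ is the process $\bar\Delta(\bar\mu-r\bar S)$. *)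

(* Defs.v *)
From HB Require Import structures.
From mathcomp Require Export all_boot all_order all_algebra.
From mathcomp Require Export all_classical all_reals all_analysis.
Export Order.TTheory GRing.Theory Num.Theory.
Export numFieldNormedType.Exports.

Set Implicit Arguments.
Unset Strict Implicit.
Unset Printing Implicit Defensive.

#[global] Open Scope classical_set_scope.
#[global] Open Scope ring_scope.

(* The time interval: [0, oo) if h = +oo, and [0, T] if h = T%:E. *)
Definition time_set (R : realType) (h : \bar R) : set R :=
  [set t | 0 <= t /\ (t%:E <= h)%E].

(* A process takes the time first. Only its values at times in [time_set h]
   are meaningful. *)
Definition process (R : realType) (Omega : Type) (m n : nat) :=
  R -> Omega -> 'M[R]_(m, n).

Section ProbabilitySpace.
Context (R : realType) (d : measure_display) (Omega : measurableType d).
Context (P : probability Omega R) (h : \bar R).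

Record filtration (F : R -> set (set Omega)) : Prop := Filtration {
  filtration_sigma : forall t, time_set h t -> sigma_algebra [set: Omega] (F t);
  filtration_sub : forall t, time_set h t -> F t `<=` measurable;
  filtration_mono : forall s t, time_set h s -> time_set h t ->
    s <= t -> F s `<=` F t }.

(* "almost everywhere" and "on a set of positive measure" in Omega x time *)
Definition almost_everywhere_time (Q : R -> Omega -> Prop) : Prop :=
  {ae (P \x (@lebesgue_measure R))%E,
    forall z, time_set h z.2 -> Q z.2 z.1}.

Definition with_positive_measure (Q : R -> Omega -> Prop) : Prop :=
  (0 < (P \x (@lebesgue_measure R))%E
         [set z | time_set h z.2 /\ Q z.2 z.1])%E.

(* [almost_surely Q]: P-almost surely, [Q t] holds at all times t; with Q an
   equality of processes, this is indistinguishability. *)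
Definition almost_surely (Q : R -> Omega -> Prop) : Prop :=
  {ae P, forall w, forall t, time_set h t -> Q t w}.

Definition cvg0_in_probability (X : nat -> Omega -> \bar R) : Prop :=
  forall eps : R, 0 < eps ->
    P [set w | (eps%:E <= X n w)%E] @[n --> \oo] --> 0%E.

Context (F : R -> set (set Omega)).

Definition adapted m n (X : process R Omega m n) : Prop :=
  forall t i j (B : set R), time_set h t -> measurable B ->
    F t ((fun w => X t w i j) @^-1` B).

Definition adapted_measurable m n (X : process R Omega m n) : Prop :=
  adapted X /\
  forall i j, measurable_fun ([set: Omega] `*` time_set h)
    (fun z : Omega * R => X z.2 z.1 i j).

Definition continuous_paths m n (X : process R Omega m n) : Prop :=
  {ae P, forall w, forall i j,
    {within time_set h, continuous (fun t => X t w i j)}}.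

Definition calL1 m n (X : process R Omega m n) : Prop :=
  adapted_measurable X /\
  almost_surely (fun t w => forall i j,
    (@lebesgue_measure R).-integrable `[0, t] (fun s => (X s w i j)%:E)).

Definition calL2 m n (X : process R Omega m n) : Prop :=
  adapted_measurable X /\
  almost_surely (fun t w => forall i j,
    (@lebesgue_measure R).-integrable `[0, t] (fun s => (X s w i j ^+ 2)%:E)).

Definition time_integral m n (X : process R Omega m n) : process R Omega m n :=
  fun t w => \matrix_(i, j) \int[@lebesgue_measure R]_(s in `[0, t]) X s w i j.

Context (K : nat).

(* The last clause, with A in F_s and arbitrary Borel sets B_k, says that
   W(t) - W(s) is independent of F_s with distribution N(0, (t - s) I_K)
   (the rectangles are a generating pi-system of the Borel sets of R^K).
   The second parameter of [normal_prob] is the standard deviation. *)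
Record wiener_process (W : process R Omega K 1) : Prop := WienerProcess {
  wiener_adapted : adapted W;
  wiener_continuous : continuous_paths W;
  wiener_start : {ae P, forall w, W 0 w = 0};
  wiener_increments : forall s t (A : set Omega) (B : 'I_K -> set R),
    time_set h s -> time_set h t -> s < t -> F s A ->
    (forall k, measurable (B k)) ->
    P (A `&` [set w | forall k, B k (W t w k 0 - W s w k 0)]) =
    (P A * \prod_(k < K) normal_prob 0 (Num.sqrt (t - s)) (B k))%E }.

(* The simple process
     sum_(i < n) xi_i 1_(t_i, t_(i+1)],
   xi_i bounded and F_(t_i)-measurable. *)
Record simple_process m := SimpleProcess {
  simple_size : nat;
  simple_time : nat -> R;
  simple_coef : nat -> Omega -> 'M[R]_(m, K);
  _ : forall i, (i <= simple_size)%N -> time_set h (simple_time i);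
  _ : forall i, (i < simple_size)%N -> simple_time i <= simple_time i.+1;
  _ : forall i j k (B : set R), (i < simple_size)%N -> measurable B ->
        F (simple_time i) ((fun w => simple_coef i w j k) @^-1` B);
  _ : exists C : R, forall i w j k, (i < simple_size)%N ->
        `|simple_coef i w j k| <= C }.

Definition simple_value m (th : simple_process m) : process R Omega m K :=
  fun s w => \sum_(i < simple_size th)
    \1_`]simple_time th i, simple_time th i.+1] s *: simple_coef th i w.

Context (W : process R Omega K 1).

Definition simple_integral m (th : simple_process m) : process R Omega m 1 :=
  fun t w => \sum_(i < simple_size th) simple_coef th i w *m
    (W (Num.min (simple_time th i.+1) t) w - W (Num.min (simple_time th i) t) w).

(* [I] is (a version of) the Ito integral int_0^. th dW of a process [th] in
   calL2: the continuous adapted process that is the limit in probability of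
   the integrals of simple processes [thn n] such that
   int_0^t |thn n - th|^2 ds --> 0 in probability for all t. *)
Definition ito_integral m (th : process R Omega m K) (I : process R Omega m 1)
    : Prop :=
  [/\ adapted I, continuous_paths I &
    exists thn : nat -> simple_process m, forall t, time_set h t ->
      (forall i k, cvg0_in_probability (fun n w =>
         (\int[@lebesgue_measure R]_(s in `[0%R, t])
            ((simple_value (thn n) s w i k - th s w i k) ^+ 2)%:E)%E)) /\
      (forall i, cvg0_in_probability (fun n w =>
         `|simple_integral (thn n) t w i 0 - I t w i 0|%:E))].

(* X(t) = X(0) + int_0^t a ds + int_0^t v dW *)
Definition ito_representation m (X a : process R Omega m 1)
    (v : process R Omega m K) : Prop :=
  exists2 I : process R Omega m 1, ito_integral v I &
    almost_surely (fun t w => X t w = X 0 w + time_integral a t w + I t w).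

Definition mulp m n p (X : process R Omega m n) (Y : process R Omega n p)
    : process R Omega m p :=
  fun t w => X t w *m Y t w.

(* calL(X) for an Ito process X with dX = a dt + v dW, given by its drift [a]
   and its dispersion [v] *)
Definition calL m n (a : process R Omega n 1) (v : process R Omega n K)
    (Delta : process R Omega m n) : Prop :=
  [/\ adapted_measurable Delta, calL1 (mulp Delta a) & calL2 (mulp Delta v)].

Section Market.
Context (N : nat).

Record securities_market_model (S D mu : process R Omega N.+1 1)
    (sigma : process R Omega N.+1 K) : Prop := SecuritiesMarketModel {
  market_prices : adapted_measurable S;
  market_dividends : adapted_measurable D;
  market_dividends0 : {ae P, forall w, D 0 w = 0};
  market_drift : calL1 mu;
  market_dispersion : calL2 sigma;
  market_gains : ito_representation (fun t w => S t w + D t w) mu sigma }.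

Context (S D mu : process R Omega N.+1 1) (sigma : process R Omega N.+1 K).

Definition trading_strategy (Delta : process R Omega 1 N.+1) : Prop :=
  adapted_measurable Delta.

Definition value_process (Delta : process R Omega 1 N.+1) : R -> Omega -> R :=
  fun t w => mulp Delta S t w 0 0.

(* int_0^t Delta dG = int_0^t Delta mu ds + int_0^t Delta sigma dW *)
Definition self_financing (Delta : process R Omega 1 N.+1) : Prop :=
  calL mu sigma Delta /\
  ito_representation (mulp Delta S) (mulp Delta mu) (mulp Delta sigma).

Definition instantaneously_riskless (Delta : process R Omega 1 N.+1) : Prop :=
  trading_strategy Delta /\
  almost_everywhere_time (fun t w => mulp Delta sigma t w = 0).

(* As b is self-financing, the dispersion of its value process b S
   is b sigma. *)
Definition money_market_account (b : process R Omega 1 N.+1) : Prop :=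
  [/\ self_financing b,
      almost_surely (fun t w => 0 < value_process b t w) &
      instantaneously_riskless b].

Definition scalar_process (x : R -> Omega -> R) : process R Omega 1 1 :=
  fun t w => (x t w)%:M.

Definition interest_rate (M r : R -> Omega -> R) : Prop :=
  calL1 (scalar_process r) /\
  almost_surely (fun t w =>
    M t w = M 0 w * expR (time_integral (scalar_process r) t w 0 0)).

(* The Ito process 1/M has drift - r/M and dispersion 0. *)
Definition calL_invM (M r : R -> Omega -> R) (X : process R Omega N.+1 1)
    : Prop :=
  calL (scalar_process (fun t w => - (r t w / M t w))) (fun _ _ => 0) X.

Definition excess_drift (r : R -> Omega -> R) : process R Omega N.+1 1 :=
  fun t w => mu t w - r t w *: S t w.

(* The drift and the dispersion of the gains process in units of the money
   market account are (mu - r S)/M and sigma/M. *)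
Definition calL_G_invM (M r : R -> Omega -> R) (Delta : process R Omega 1 N.+1)
    : Prop :=
  calL (fun t w => (M t w)^-1 *: excess_drift r t w)
       (fun t w => (M t w)^-1 *: sigma t w) Delta.

Definition excess_return (r : R -> Omega -> R) (Delta : process R Omega 1 N.+1)
    : R -> Omega -> R :=
  fun t w => mulp Delta (excess_drift r) t w 0 0.

Definition zero_value_instantaneous_arbitrage (Delta : process R Omega 1 N.+1)
    : Prop :=
  [/\ instantaneously_riskless Delta,
      almost_everywhere_time (fun t w => value_process Delta t w = 0),
      almost_everywhere_time (fun t w => 0 <= mulp Delta mu t w 0 0) &
      with_positive_measure (fun t w => 0 < mulp Delta mu t w 0 0)].

Definition instantaneously_arbitrage_free : Prop :=
  ~ exists Delta, zero_value_instantaneous_arbitrage Delta.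

Definition instantaneous_arbitrage (M r : R -> Omega -> R)
    (Delta : process R Omega 1 N.+1) : Prop :=
  [/\ instantaneously_riskless Delta,
      calL_G_invM M r Delta,
      almost_everywhere_time (fun t w => 0 <= excess_return r Delta t w) &
      with_positive_measure (fun t w => 0 < excess_return r Delta t w)].

End Market.
End ProbabilitySpace.

(* Main.v *)
Require Import Defs.
From HB Require Import structures.
From mathcomp Require Import measurable_realfun ring lra.

(** For a money market account [b] the dispersion of M = b S vanishes almost
    everywhere, so its Ito integral is indistinguishable from 0 and
    M(t) = M(0) + int_0^t b mu ds; comparing with M(t) = M(0) exp (int_0^t r ds)
    and differentiating almost everywhere gives b mu = r M.  Hence, for a
    riskless [Delta] with excess return e, the strategy
    theta = k (Delta - (Delta S / M) b), k = M e / (M^2 + e^2), is riskless, has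
    zero value and has drift k e = M g with g = e^2 / (M^2 + e^2) in [0, 1].  If e
    is not almost everywhere 0, theta is a zero-value arbitrage.  Reinvesting its
    gains in the money market, i.e. adding A b with A(t) = int_0^t g ds, makes it
    self-financing, since d(A M) = (M g + A b mu) dt.

    As the filtration is not assumed complete, A need not be adapted; it is
    replaced by an indistinguishable adapted process, built from conditional
    expectations at rational times. *)

Set Implicit Arguments.
Unset Strict Implicit.
Unset Printing Implicit Defensive.

(** The Ito integral is known only as a limit in probability along some unspecified sequence of
    simple processes, so a null dispersion does not at once give a null integral: the approximating
    integrals must be shown to be small when their quadratic variations are. A Lenglart-type
    estimate does this, starting from second moments of bounded discrete integrals. The isometry
    takes the form of an inequality with factor 8 K: 8 from a comparison of Gaussian densities, K
    from Cauchy-Schwarz over the coordinates of [W].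

    The scaling k has two purposes. It carries the sign of e, so that a riskless strategy losing
    against the money market is reversed. And it bounds the drift of theta by M: statement (4)
    ranges over riskless strategies without any integrability, so e itself could not be integrated
    in time, whereas g always can. *)

Section Basics.
Context (R : realType) (d : measure_display) (Omega : measurableType d).
Context (P : probability Omega R) (h : \bar R).
Local Notation mu := (@lebesgue_measure R).

Lemma time_set_itv : exists i : interval R, time_set h = [set` i].
Proof.
case: h => [r| |].
- exists `[0, r]; apply/seteqP; split => t; rewrite /time_set /= in_itv/= lee_fin.
    by move=> [-> ->].
  by move=> /andP[-> ->].
- exists `[0, +oo[; apply/seteqP; split => t; rewrite /time_set /= in_itv/= ?leey ?andbT.
    by case.
  by move=> ->.
(* For [h = -oo] there is no time at all; []0, 0[] is an empty interval. *)
- exists `]0, 0[; apply/seteqP; split => t; rewrite /time_set /= in_itv/=.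
    by rewrite leeNy_eq => -[].
  by move=> /andP[/lt_trans/[apply]]; rewrite ltxx.
Qed.

Lemma measurable_time_set : measurable (time_set h).
Proof. by have [i ->] := time_set_itv; exact: measurable_itv. Qed.

Lemma time_set_sub s t : 0 <= s -> s <= t -> time_set h t -> time_set h s.
Proof.
by move=> s0 st [_ th]; split=> //; apply: le_trans th; rewrite lee_fin.
Qed.

Lemma sub_itv_time_set t : time_set h t -> `[0, t] `<=` time_set h.
Proof.
by move=> Tt s /=; rewrite in_itv/= => /andP[s0 st]; exact: time_set_sub Tt.
Qed.

Lemma measurable_domain : measurable ([set: Omega] `*` time_set h).
Proof. by apply: measurableX => //; exact: measurable_time_set. Qed.

End Basics.

(** * Null sets of a product measure and their sections *)

Section Sections.
Context d1 d2 (T1 : measurableType d1) (T2 : measurableType d2) (R : realType).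
Context (m1 : {measure set T1 -> \bar R}).
Context (m2 : {sigma_finite_measure set T2 -> \bar R}).

(** The product measure of a measurable null cover is the integral of the measures of its sections,
    and a nonnegative function with integral 0 vanishes almost everywhere. *)
Lemma ae_xsection (Q : T1 -> T2 -> Prop) :
  {ae (m1 \x m2)%E, forall z, Q z.1 z.2} ->
  {ae m1, forall x, {ae m2, forall y, Q x y}}.
Proof.
move=> [N [mN N0 QN]].
have mxN : measurable_fun [set: T1] ((fun x => m2 (xsection N x)) : T1 -> \bar R).
  exact: measurable_fun_xsection.
have : (\int[m1]_x `|m2 (xsection N x)| = 0)%E.
  by rewrite -[RHS]N0; apply: eq_integral => w _; rewrite gee0_abs.
move=> /(ae_eq_integral_abs _ measurableT mxN); apply: filterS => x /(_ I) xN0.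
exists (xsection N x); split => //; first exact: measurable_xsection.
by move=> y /= nQ; rewrite /xsection /= inE; exact: QN.
Qed.

(** Here the exceptional set must itself be measurable: null sections alone do not provide a
    measurable null cover. *)
Lemma ae_of_xsection (Q : T1 -> T2 -> Prop) :
  measurable [set z : T1 * T2 | ~ Q z.1 z.2] ->
  {ae m1, forall x, {ae m2, forall y, Q x y}} ->
  {ae (m1 \x m2)%E, forall z, Q z.1 z.2}.
Proof.
set N := [set z | _] => mN aeQ; exists N; split => //.
have mxN : measurable_fun [set: T1] ((fun x => m2 (xsection N x)) : T1 -> \bar R).
  exact: measurable_fun_xsection.
transitivity (\int[m1]_x `|m2 (xsection N x)|)%E.
  by apply: eq_integral => w _; rewrite gee0_abs.
apply/(ae_eq_integral_abs _ measurableT mxN); apply: filterS aeQ => x xQ _.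
apply/negligibleP; first exact: measurable_xsection.
apply: negligibleS xQ => y; rewrite /xsection /= inE.
by [].
Qed.

End Sections.

(** * Closure properties of adapted measurable processes *)

Section AdaptedFun.
Context (R : realType) (d : measure_display) (Omega : measurableType d).
Context (h : \bar R) (F : R -> set (set Omega)) (hF : filtration h F).

(** [F t] is a mere set of sets; passing to [g_sigma_algebraType (F t)] turns adaptedness into
    ordinary measurability, so that the usual closure lemmas for measurable functions apply. *)
Definition adapted_measurable_fun (x : R -> Omega -> R) :=
  (forall t, time_set h t ->
    measurable_fun [set: g_sigma_algebraType (F t)]
      (x t : g_sigma_algebraType (F t) -> R)) /\
  measurable_fun ([set: Omega] `*` time_set h)
    (fun z : Omega * R => x z.2 z.1).

Lemma measurable_filtration t (A : set (g_sigma_algebraType (F t))) :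
  time_set h t -> measurable A <-> F t A.
Proof.
by move=> Tt; rewrite measurable_g_measurableTypeE//; exact: (filtration_sigma hF).
Qed.

Lemma measurable_fun_filtrationP t (x : Omega -> R) : time_set h t ->
  measurable_fun [set: g_sigma_algebraType (F t)]
    (x : g_sigma_algebraType (F t) -> R) <->
  (forall B : set R, measurable B -> F t (x @^-1` B)).
Proof.
move=> Tt; split => [mx B mB|Fx _ B mB].
  apply/(measurable_filtration _ Tt); rewrite -[_ @^-1` _]setTI.
  exact: mx.
by rewrite setTI; apply/measurable_filtration => //; exact: Fx.
Qed.

Lemma filtration_measurable t : time_set h t ->
  measurable_fun [set: Omega] (id : Omega -> g_sigma_algebraType (F t)).
Proof.
move=> Tt _ B mB; rewrite setTI; apply: (filtration_sub hF Tt).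
exact/measurable_filtration.
Qed.

Lemma filtration_measurable_fun t (x : Omega -> R) : time_set h t ->
  measurable_fun [set: g_sigma_algebraType (F t)]
    (x : g_sigma_algebraType (F t) -> R) ->
  measurable_fun [set: Omega] x.
Proof.
move=> Tt mx.
exact: (measurableT_comp (f := (x : g_sigma_algebraType (F t) -> R)) mx
  (filtration_measurable Tt)).
Qed.

Lemma filtration_mono_measurable_fun s t (x : Omega -> R) :
  time_set h s -> time_set h t -> s <= t ->
  measurable_fun [set: g_sigma_algebraType (F s)]
    (x : g_sigma_algebraType (F s) -> R) ->
  measurable_fun [set: g_sigma_algebraType (F t)]
    (x : g_sigma_algebraType (F t) -> R).
Proof.
move=> Ts Tt st /(measurable_fun_filtrationP _ Ts) mx.
apply/(measurable_fun_filtrationP _ Tt) => B mB.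
by apply: (filtration_mono hF Ts Tt st); exact: mx.
Qed.

Lemma adapted_measurableP m n (X : process R Omega m n) :
  adapted_measurable h F X <->
  forall i j, adapted_measurable_fun (fun t w => X t w i j).
Proof.
split => [[aX mX] i j|X_]; split.
- move=> t Tt; apply/measurable_fun_filtrationP => // B mB; exact: aX.
- exact: mX.
- move=> t i j B Tt mB; have [+ _] := X_ i j => /(_ _ Tt).
  by move/measurable_fun_filtrationP; exact.
- by move=> i j; have [] := X_ i j.
Qed.

Lemma adapted_cst (c : R) : adapted_measurable_fun (fun _ _ => c).
Proof. by split => [t _|]; exact: measurable_cst. Qed.

Lemma adaptedD x y : adapted_measurable_fun x -> adapted_measurable_fun y ->
  adapted_measurable_fun (fun t w => x t w + y t w).
Proof.
move=> [ax mx] [ay my]; split => [t Tt|]; last exact: measurable_funD.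
by apply: measurable_funD; [exact: ax|exact: ay].
Qed.

Lemma adaptedM x y : adapted_measurable_fun x -> adapted_measurable_fun y ->
  adapted_measurable_fun (fun t w => x t w * y t w).
Proof.
move=> [ax mx] [ay my]; split => [t Tt|]; last exact: measurable_funM.
by apply: measurable_funM; [exact: ax|exact: ay].
Qed.

Lemma adapted_comp (f : R -> R) x : measurable_fun [set: R] f ->
  adapted_measurable_fun x -> adapted_measurable_fun (fun t w => f (x t w)).
Proof.
move=> mf [ax mx]; split => [t Tt|]; last exact: measurableT_comp.
by apply: (measurableT_comp mf); exact: ax.
Qed.

Lemma adaptedN x : adapted_measurable_fun x ->
  adapted_measurable_fun (fun t w => - x t w).
Proof. by apply: adapted_comp. Qed.

Lemma adapted_sum (I : Type) (s : seq I) (x : I -> R -> Omega -> R) :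
  (forall i, adapted_measurable_fun (x i)) ->
  adapted_measurable_fun (fun t w => \sum_(i <- s) x i t w).
Proof.
move=> xa; elim: s => [|i s IH].
  by under eq_fun do under eq_fun do rewrite big_nil; exact: adapted_cst.
by under eq_fun do under eq_fun do rewrite big_cons; exact: adaptedD.
Qed.

Lemma adapted_mulp m n p (X : process R Omega m n) (Y : process R Omega n p) :
  adapted_measurable h F X -> adapted_measurable h F Y ->
  adapted_measurable h F (mulp X Y).
Proof.
move=> /adapted_measurableP Xa /adapted_measurableP Ya.
apply/adapted_measurableP => i j; rewrite /mulp.
under eq_fun do under eq_fun do rewrite mxE.
by apply: adapted_sum => k; exact: adaptedM.
Qed.

Lemma adapted_scale m n (x : R -> Omega -> R) (Y : process R Omega m n) :
  adapted_measurable_fun x -> adapted_measurable h F Y ->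
  adapted_measurable h F (fun t w => x t w *: Y t w).
Proof.
move=> xa /adapted_measurableP Ya; apply/adapted_measurableP => i j.
by under eq_fun do under eq_fun do rewrite mxE; exact: adaptedM.
Qed.

Lemma adapted_add m n (X Y : process R Omega m n) :
  adapted_measurable h F X -> adapted_measurable h F Y ->
  adapted_measurable h F (fun t w => X t w + Y t w).
Proof.
move=> /adapted_measurableP Xa /adapted_measurableP Ya.
apply/adapted_measurableP => i j.
by under eq_fun do under eq_fun do rewrite mxE; exact: adaptedD.
Qed.

(** Inversion is not continuous at 0. Writing it as x times a real power of x^2 reduces it to
    measurable functions, and at 0 the factor x gives the conventional value 0. *)
Lemma measurable_inv : measurable_fun [set: R] (@GRing.inv R).
Proof.
have -> : @GRing.inv R = fun x => x * ((x ^+ 2) `^ (-1)).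
  apply/funext => x; rewrite powR_inv1 ?sqr_ge0// -exprVn.
  have [->|x0] := eqVneq x 0; first by rewrite invr0 mul0r.
  by rewrite expr2 mulrA mulfV// mul1r.
apply: measurable_funM => //.
exact: (measurableT_comp (measurable_powR (-1)) (exprn_measurable 2)).
Qed.

Lemma adaptedV x : adapted_measurable_fun x ->
  adapted_measurable_fun (fun t w => (x t w)^-1).
Proof. by apply: adapted_comp; exact: measurable_inv. Qed.

End AdaptedFun.

(** * Second moment and mean of a product of independent variables *)

Section Independence.
Local Open Scope ereal_scope.
Context (R : realType) (d : measure_display) (Omega : measurableType d).
Context (P : probability Omega R).
Context (nu : probability (measurableTypeR R) R).
Context (Y Z : Omega -> R).
Hypothesis mY : measurable_fun [set: Omega] Y.
Hypothesis mZ : measurable_fun [set: Omega] Z.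
(** Taking the whole line for [A] shows that [nu] is the law of [Z]. Independence and law come in
    one formula, the shape in which Wiener increments provide them. *)
Hypothesis indepYZ : forall A B : set R, measurable A -> measurable B ->
  P (Y @^-1` A `&` Z @^-1` B) = P (Y @^-1` A) * nu B.

Let YR : Omega -> measurableTypeR R := Y.
Let YZ : Omega -> (measurableTypeR R * measurableTypeR R)%type := fun w => (Y w, Z w).

Let mYR : measurable_fun [set: Omega] YR. Proof. exact: mY. Qed.
Let mYZ : measurable_fun [set: Omega] YZ.
Proof. by apply: measurable_fun_pair => //. Qed.

HB.instance Definition _ := isMeasurableFun.Build _ _ _ _ YR mYR.
HB.instance Definition _ := isMeasurableFun.Build _ _ _ _ YZ mYZ.

Let law : probability (measurableTypeR R) R := distribution P YR.

Lemma indep_law (C : set (measurableTypeR R * measurableTypeR R)) :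
  measurable C -> (law \x nu) C = distribution P YZ C.
Proof.
apply: product_measure_unique => A B mA mB.
by rewrite -indepYZ.
Qed.

(** The joint law of [Y] and [Z] agrees with [law \x nu] on rectangles, hence everywhere, and
    Tonelli's theorem applies to it. *)
Lemma ge0_integral_indep (f : R -> R -> \bar R) :
  measurable_fun [set: measurableTypeR R * measurableTypeR R]
    (fun z => f z.1 z.2) ->
  (forall y z, 0 <= f y z) ->
  \int[P]_w f (Y w) (Z w) = \int[law]_y \int[nu]_z f y z.
Proof.
move=> mf f0.
transitivity (\int[law \x nu]_z f z.1 z.2); last first.
  by rewrite (@fubini_tonelli1 _ _ (measurableTypeR R) (measurableTypeR R) R
    law nu (fun z => f z.1 z.2) mf).
rewrite (eq_measure_integral (distribution P YZ)); last first.
  by move=> A mA _; exact: indep_law.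
by rewrite ge0_integral_distribution// => -[].
Qed.

Lemma integral_sqr_indep : \int[P]_w ((Y w * Z w) ^+ 2)%:E =
  \int[P]_w ((Y w) ^+ 2)%:E * \int[nu]_z (z ^+ 2)%:E.
Proof.
rewrite (ge0_integral_indep (f := fun y z => ((y * z) ^+ 2)%:E)); first last.
- by move=> y z; rewrite lee_fin sqr_ge0.
- apply/measurable_EFinP; apply: (measurable_funX 2).
  by apply: measurable_funM.
under eq_integral => y _.
  under eq_integral do rewrite exprMn EFinM.
  rewrite ge0_integralZl//; first last.
  - by rewrite lee_fin sqr_ge0.
  - by move=> z _; rewrite lee_fin sqr_ge0.
  - by apply/measurable_EFinP; exact: (measurable_funX 2).
  over.
rewrite ge0_integralZr//; first last.
- by apply: integral_ge0 => z _; rewrite lee_fin sqr_ge0.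
- by move=> z _; rewrite lee_fin sqr_ge0.
- by apply/measurable_EFinP; exact: (measurable_funX 2).
congr *%E.
rewrite ge0_integral_distribution//.
- by apply/measurable_EFinP; exact: (measurable_funX 2).
- by move=> z; rewrite lee_fin sqr_ge0.
Qed.

Hypothesis nuN : forall B : set R, measurable B -> nu (-%R @^-1` B) = nu B.

Lemma ge0_integral_symmetric (f : R -> \bar R) :
  measurable_fun [set: R] f -> (forall z, 0 <= f z) ->
  \int[nu]_z f (- z)%R = \int[nu]_z f z.
Proof.
move=> mf f0.
pose o : measurableTypeR R -> measurableTypeR R := -%R.
have mo : measurable_fun [set: measurableTypeR R] o by exact: measurable_funN.
transitivity (\int[pushforward nu o]_z f z); last first.
  apply: eq_measure_integral => A mA _; exact: nuN.
by rewrite (ge0_integral_pushforward mo).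
Qed.

(** Replacing z by -z, which preserves [nu], exchanges the positive and negative parts of y z, so
    both have the same integral; integrability makes it finite and the difference is 0. Neither
    factor is integrated on its own. *)
Lemma integral_mul_indep :
  P.-integrable [set: Omega] (fun w => (Y w * Z w)%:E) ->
  \int[P]_w (Y w * Z w)%:E = 0.
Proof.
move=> iYZ; rewrite integralE.
have mm : measurable_fun [set: measurableTypeR R * measurableTypeR R]
    (fun z => (z.1 * z.2)%:E).
  by apply/measurable_EFinP; exact: measurable_funM.
have -> : \int[P]_w (fun w => (Y w * Z w)%:E)^\- w =
          \int[P]_w (fun w => (Y w * Z w)%:E)^\+ w.
  under eq_integral do rewrite funenegE.
  under [RHS]eq_integral do rewrite funeposE.
  rewrite (ge0_integral_indep (f := fun y z => maxe (- (y * z)%:E) 0)); first last.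
  - by move=> y z; rewrite le_max lexx orbT.
  - by apply: measurable_maxe => //; exact: measurableT_comp.
  rewrite (ge0_integral_indep (f := fun y z => maxe (y * z)%:E 0)); first last.
  - by move=> y z; rewrite le_max lexx orbT.
  - by apply: measurable_maxe.
  apply: eq_integral => y _.
  rewrite -(ge0_integral_symmetric (f := fun z => maxe (y * z)%:E 0)).
  - by apply: eq_integral => z _; rewrite mulrN EFinN.
  - apply: measurable_maxe => //; apply/measurable_EFinP.
    exact: mulrl_measurable.
  - by move=> z; rewrite le_max lexx orbT.
rewrite subee//.
have := integral_funepos_lt_pinfty measurableT iYZ.
by rewrite ge0_fin_numE// integral_ge0// => w _; rewrite funepos_ge0.
Qed.

End Independence.

(** [k] and the Radon-Nikodym derivative of [nu] have the same integral over every measurable set,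
    so they agree almost everywhere, and the change of variables formula for the derivative carries
    over to [k]. *)
Lemma ge0_integral_density (R : realType) (d : measure_display)
    (T : measurableType d) (m : {sigma_finite_measure set T -> \bar R})
    (nu : {finite_measure set T -> \bar R}) (k f : T -> \bar R) :
  m.-integrable [set: T] k ->
  (forall A, measurable A -> nu A = (\int[m]_(x in A) k x)%E) ->
  measurable_fun [set: T] f -> (forall x, 0 <= f x)%E ->
  (\int[nu]_x f x = \int[m]_x (f x * k x))%E.
Proof.
move=> ik nuE mf f0; have mk := measurable_int _ ik.
have dom : nu `<< m.
  apply/null_content_dominatesP => A mA mA0.
  by rewrite nuE// null_set_integral//; exact: measurable_funTS.
rewrite -(Radon_Nikodym_SigmaFinite.change_of_variables dom f0 measurableT mf).
have iRN := Radon_Nikodym_SigmaFinite.f_integrable dom.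
apply: ae_eq_integral => //.
- by apply: emeasurable_funM => //; exact: measurable_int iRN.
- exact: emeasurable_funM.
- apply: ae_eqe_mul2l; apply: integral_ae_eq => //= A _ mA.
  by rewrite -Radon_Nikodym_SigmaFinite.f_integral// nuE.
Qed.

(** * The centred normal law: symmetry and a second moment bound *)

Section Gaussian.
Local Open Scope ereal_scope.
Context (R : realType).
Local Notation mu := (@lebesgue_measure R).

(** The density is even and Lebesgue measure is invariant under reflection. *)
Lemma normal_probN (s : R) (B : set R) : s != 0%R -> measurable B ->
  normal_prob 0 s (-%R @^-1` B) = normal_prob 0 s B.
Proof.
move=> s0 mB; rewrite /normal_prob.
pose o : measurableTypeR R -> measurableTypeR R := -%R.
have mo : measurable_fun [set: measurableTypeR R] o by exact: measurable_funN.
have mpdf : measurable_fun [set: R] (fun x => (normal_pdf 0 s x)%:E).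
  by apply/measurable_EFinP; exact: measurable_normal_pdf.
transitivity (\int[pushforward mu o]_(x in B) (normal_pdf 0 s x)%:E); last first.
  by apply: eq_measure_integral => A mA _; exact: lebesgue_measureN.
rewrite (ge0_integral_pushforward mo)//; last 2 first.
- exact: measurable_funTS.
- by move=> x _; rewrite lee_fin normal_pdf_ge0.
apply: eq_integral => x _; rewrite /o /= !normal_pdfE//= /normal_fun.
by rewrite !subr0 sqrrN.
Qed.

Lemma ge0_integral_normal (s : R) (f : R -> \bar R) : s != 0%R ->
  measurable_fun [set: R] f -> (forall x, 0 <= f x) ->
  \int[normal_prob 0 s]_x f x = \int[mu]_x (f x * (normal_pdf 0 s x)%:E).
Proof.
move=> s0 mf f0; apply: ge0_integral_density => //.
exact: integrable_normal_pdf.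
Qed.

(* With u = x^2 / (4 s^2) one has u <= expR u, and the factor expR u turns the
   density of N(0, s^2) into sqrt 2 times that of N(0, 2 s^2). *)
Lemma normal_second_moment (s : R) : s != 0%R ->
  \int[normal_prob 0 s]_x (x ^+ 2)%:E <= (8 * s ^+ 2)%:E.
Proof.
move=> s0.
have mpdf t : measurable_fun [set: R] (fun x => (normal_pdf 0 t x)%:E).
  by apply/measurable_EFinP; exact: measurable_normal_pdf.
have q2 : (Num.sqrt 2 != 0 :> R)%R by rewrite gt_eqF// sqrtr_gt0.
have q2s : (Num.sqrt 2 * s != 0)%R by rewrite mulf_neq0.
rewrite ge0_integral_normal//; last 2 first.
- by apply/measurable_EFinP; exact: (measurable_funX 2).
- by move=> x; rewrite lee_fin sqr_ge0.
rewrite -[leRHS]mule1 -(integral_normal_pdf 0 (Num.sqrt 2 * s)%R).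
rewrite -ge0_integralZl//; last 3 first.
- exact: mpdf.
- by move=> x _; rewrite lee_fin normal_pdf_ge0.
- by rewrite lee_fin mulr_ge0// sqr_ge0.
apply: ge0_le_integral => //.
- by move=> x _; rewrite mule_ge0// lee_fin ?sqr_ge0 ?normal_pdf_ge0.
- under eq_fun do rewrite -EFinM; apply/measurable_EFinP.
  by apply: measurable_funM => //; exact: measurable_normal_pdf.
- under eq_fun do rewrite -EFinM; apply/measurable_EFinP.
  by apply: measurable_funM => //; exact: measurable_normal_pdf.
move=> x _; rewrite -!EFinM lee_fin !normal_pdfE// /normal_peak /normal_fun.
rewrite !subr0 exprMn sqr_sqrtr//.
set u := (x ^+ 2 / (4 * s ^+ 2))%R.
have s2 : (0 < s ^+ 2)%R by rewrite exprn_even_gt0.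
have -> : (- x ^+ 2 / (s ^+ 2 *+ 2) = - u - u)%R by rewrite /u; field.
have -> : (- x ^+ 2 / (2 * s ^+ 2 *+ 2) = - u)%R by rewrite /u; field.
have -> : (x ^+ 2 = 4 * s ^+ 2 * u)%R by rewrite /u; field.
have -> : (2 * s ^+ 2 * pi *+ 2 = 2 * (s ^+ 2 * pi *+ 2))%R by ring.
rewrite sqrtrM// invfM.
set p := ((Num.sqrt (s ^+ 2 * pi *+ 2))^-1)%R.
set q := ((Num.sqrt 2)^-1)%R.
rewrite expRD; set e := expR (- u).
have p0 : (0 <= p)%R by rewrite invr_ge0.
have e0 : (0 <= e)%R by exact: expR_ge0.
(* The constant 8 is 4 * 2: the 4 from x^2 = 4 s^2 u, the 2 from 1 <= 2 q. Any bound linear in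
   [s ^+ 2] serves the later estimates. *)
have q12 : (1 / 2 <= q)%R.
  rewrite /q div1r lef_pV2 ?posrE ?sqrtr_gt0// -[leRHS]ger0_norm//.
  by rewrite -sqrtr_sqr ler_sqrt// ?exprn_gt0// expr2; lra.
have ue : (u * e <= 1)%R.
  rewrite /e expRN ler_pdivrMr ?expR_gt0// mul1r.
  by apply: le_trans (expR_ge1Dx u); lra.
have K0 : (0 <= 4 * s ^+ 2 * p * e)%R by do 3 (apply: mulr_ge0 => //); exact: ltW.

have -> : (4 * s ^+ 2 * u * (p * (e * e)) = 4 * s ^+ 2 * p * e * (u * e))%R by ring.
have -> : (8 * s ^+ 2 * (q * p * e) = 4 * s ^+ 2 * p * e * (2 * q))%R by ring.
by apply: ler_wpM2l => //; lra.
Qed.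

End Gaussian.

Section L2.
Context (R : realType) (d : measure_display) (Omega : measurableType d).
Context (P : probability Omega R).

Lemma integrable_sqr_bounded (f : Omega -> R) (C : R) :
  measurable_fun [set: Omega] f -> (forall w, `|f w| <= C) ->
  P.-integrable [set: Omega] (fun w => (f w ^+ 2)%:E).
Proof.
move=> mf fC.
apply: (@le_integrable _ _ _ _ _ _ _ (cst (C ^+ 2)%:E)) => //.
- by apply/measurable_EFinP; exact: (measurable_funX 2).
- move=> w _ /=; rewrite lee_fin !ger0_norm ?sqr_ge0// -(real_normK (num_real (f w))).
  by rewrite lerXn2r ?nnegrE// (le_trans _ (fC w)).
- exact: finite_measure_integrable_cst.
Qed.

End L2.

(** Cauchy-Schwarz: for n + 1 terms with sum S, the sum of the squares of (n + 1) a_k - S expands to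
    n + 1 times the difference of the two sides. *)
Lemma sqr_sum_le (R : realFieldType) (K : nat) (a : 'I_K -> R) :
  (\sum_k a k) ^+ 2 <= K%:R * \sum_k a k ^+ 2.
Proof.
case: K a => [|n] a; first by rewrite mul0r big_ord0 expr0n.
set S := \sum_k a k.
have : 0 <= \sum_k (n.+1%:R * a k - S) ^+ 2.
  by apply: sumr_ge0 => i _; exact: sqr_ge0.
have -> : \sum_k (n.+1%:R * a k - S) ^+ 2 = n.+1%:R * (n.+1%:R * \sum_k a k ^+ 2 - S ^+ 2).
  have -> : \sum_k (n.+1%:R * a k - S) ^+ 2 =
      \sum_k (n.+1%:R ^+ 2 * a k ^+ 2 + (- (2 * n.+1%:R * S)) * a k + S ^+ 2).
    by apply: eq_bigr => i _; ring.
  rewrite !big_split/= -!mulr_sumr -/S sumr_const card_ord -[S *+ _]mulr_natl.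
  by ring.
by rewrite pmulr_rge0 ?ltr0n// subr_ge0.
Qed.

(** * Independence and second moments of Wiener increments *)

Section WienerIncrements.
Context (R : realType) (d : measure_display) (Omega : measurableType d).
Context (P : probability Omega R) (h : \bar R).
Context (F : R -> set (set Omega)) (hF : filtration h F).
Context (K : nat) (W : process R Omega K 1) (hW : wiener_process P h F W).

Lemma wiener_measurable t k : time_set h t ->
  measurable_fun [set: g_sigma_algebraType (F t)]
    ((fun w => W t w k 0) : g_sigma_algebraType (F t) -> R).
Proof.
move=> Tt; apply/(measurable_fun_filtrationP hF) => // B mB.
exact: (wiener_adapted hW).
Qed.

Lemma wiener_indep s t k (Y : Omega -> R) (A B : set R) :
  time_set h s -> time_set h t -> s < t ->
  measurable_fun [set: g_sigma_algebraType (F s)]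
    (Y : g_sigma_algebraType (F s) -> R) ->
  measurable A -> measurable B ->
  P (Y @^-1` A `&` (fun w => W t w k 0 - W s w k 0) @^-1` B) =
  (P (Y @^-1` A) * normal_prob 0 (Num.sqrt (t - s)) B)%E.
Proof.
move=> Ts Tt st mY mA mB.
have FA : F s (Y @^-1` A) by exact: ((measurable_fun_filtrationP hF Y Ts).1 mY A mA).
pose Bk l := if l == k then B else [set: R].
(* The other coordinates are left unconstrained, so each of their factors is a total mass 1. *)
have mBk l : measurable (Bk l) by rewrite /Bk; case: ifP.
have := wiener_increments hW Ts Tt st FA mBk.
rewrite (bigD1 k)//= [X in (_ * (_ * X))%E]big1/=; last first.
  by move=> l /negbTE lk; rewrite /Bk lk; exact: probability_setT.
rewrite mule1 {2}/Bk eqxx => <-; congr (P (_ `&` _)).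
apply/seteqP; split => w /=.
  by move=> BW l; rewrite /Bk; case: eqP => // ->.
by move=> /(_ k); rewrite /Bk eqxx.
Qed.

(** The Ito isometry for one step and one coordinate, up to the constant 8 of
    [normal_second_moment]. *)
Lemma integral_step_sqr s t k (Y : Omega -> R) :
  time_set h s -> time_set h t -> s < t ->
  measurable_fun [set: g_sigma_algebraType (F s)]
    (Y : g_sigma_algebraType (F s) -> R) ->
  (\int[P]_w ((Y w * (W t w k 0%R - W s w k 0%R)) ^+ 2)%:E <=
   (8 * (t - s))%:E * \int[P]_w (Y w ^+ 2)%:E)%E.
Proof.
move=> Ts Tt st mY.
have ts0 : Num.sqrt (t - s) != 0 by rewrite gt_eqF// sqrtr_gt0 subr_gt0.
rewrite (@integral_sqr_indep _ _ _ P (normal_prob 0 (Num.sqrt (t - s)))).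
- rewrite muleC; apply: lee_wpmul2r.
    by apply: integral_ge0 => w _; rewrite lee_fin sqr_ge0.
  apply: le_trans (normal_second_moment ts0) _.
  by rewrite sqr_sqrtr// subr_ge0 ltW.
- exact: (filtration_measurable_fun hF Ts mY).
- by apply: measurable_funB; [apply: (filtration_measurable_fun hF Tt)|
    apply: (filtration_measurable_fun hF Ts)]; exact: wiener_measurable.
- move=> A B mA mB; exact: wiener_indep.
Qed.

End WienerIncrements.

(** * One step of a simple integral *)

Section SimpleIntegral.
Context (R : realType) (d : measure_display) (Omega : measurableType d).
Context (P : probability Omega R) (h : \bar R).
Context (F : R -> set (set Omega)) (hF : filtration h F).
Context (K : nat) (W : process R Omega K 1) (hW : wiener_process P h F W).

(** Each cross term of the past [Y] with a new increment has mean 0, because [Y * xi k] is known at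
    time s and the increment is independent of it and symmetric. The factor K comes from
    [sqr_sum_le], which disposes of the products of two different coordinates. *)
Lemma step_second_moment s t (Y : Omega -> R) (xi : 'I_K -> Omega -> R) (C : R) :
  time_set h s -> time_set h t -> s < t ->
  measurable_fun [set: g_sigma_algebraType (F s)]
    (Y : g_sigma_algebraType (F s) -> R) ->
  P.-integrable [set: Omega] (fun w => (Y w ^+ 2)%:E) ->
  (forall k, measurable_fun [set: g_sigma_algebraType (F s)]
    (xi k : g_sigma_algebraType (F s) -> R)) ->
  (forall k w, `|xi k w| <= C) ->
  let Z w := Y w + \sum_k xi k w * (W t w k 0 - W s w k 0) in
  P.-integrable [set: Omega] (fun w => (Z w ^+ 2)%:E) /\
  (\int[P]_w (Z w ^+ 2)%:E <= \int[P]_w (Y w ^+ 2)%:E +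
    (8 * K%:R * (t - s))%:E * \int[P]_w (\sum_k xi k w ^+ 2)%:E)%E.
Proof.
move=> Ts Tt st mY iY mxi xiC Z.
pose dW k w := W t w k 0 - W s w k 0.
pose X k w := xi k w * dW k w.
have mYO : measurable_fun [set: Omega] Y by exact: (filtration_measurable_fun hF Ts).
have mxiO k : measurable_fun [set: Omega] (xi k).
  exact: (filtration_measurable_fun hF Ts (mxi k)).
have mdW k : measurable_fun [set: Omega] (dW k).
  by apply: measurable_funB; [apply: (filtration_measurable_fun hF Tt)|
    apply: (filtration_measurable_fun hF Ts)]; exact: (wiener_measurable hF hW).
have mX k : measurable_fun [set: Omega] (X k) by exact: measurable_funM.
have ixi k : P.-integrable [set: Omega] (fun w => (xi k w ^+ 2)%:E).
  exact: (integrable_sqr_bounded P (mxiO k) (xiC k)).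
have Xle k := integral_step_sqr hF hW k Ts Tt st (mxi k).
have iX k : P.-integrable [set: Omega] (fun w => (X k w ^+ 2)%:E).
  apply/integrableP; split; first by apply/measurable_EFinP; exact: (measurable_funX 2).
  under eq_integral do rewrite gee0_abs ?lee_fin ?sqr_ge0//.
  apply: le_lt_trans (Xle k) _.
  have fin : (\int[P]_w (xi k w ^+ 2)%:E)%E \is a fin_num by exact: integrable_fin_num (ixi k).
  by rewrite -(fineK fin) -EFinM ltry.
have iYX k : P.-integrable [set: Omega] (fun w => (Y w * X k w)%:E).
  apply: (@le_integrable _ _ _ _ _ _ _ (fun w => (Y w ^+ 2)%:E + (X k w ^+ 2)%:E)%E) => //.
  - by apply/measurable_EFinP; exact: measurable_funM.
  - move=> w _; rewrite -EFinD lee_fin [leRHS]ger0_norm ?addr_ge0 ?sqr_ge0//.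
    rewrite normrM -(real_normK (num_real (Y w))) -(real_normK (num_real (X k w))).
    have := sqr_ge0 (`|Y w| - `|X k w|).
    by have := normr_ge0 (Y w); have := normr_ge0 (X k w); nra.
  - exact: integrableD.
have YX0 k : (\int[P]_w (Y w * X k w)%:E = 0)%E.
  have ts0 : Num.sqrt (t - s) != 0 by rewrite gt_eqF// sqrtr_gt0 subr_gt0.
  have mYxi : measurable_fun [set: g_sigma_algebraType (F s)]
      ((fun w => Y w * xi k w) : g_sigma_algebraType (F s) -> R).
    exact: measurable_funM.
  rewrite /X; under eq_integral do rewrite mulrA.
  apply: (@integral_mul_indep _ _ _ P (normal_prob 0 (Num.sqrt (t - s)))
    (fun w => Y w * xi k w) (dW k)) => //.
  - exact: measurable_funM.
  - by move=> A B mA mB; exact: (wiener_indep hF hW).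
  - by move=> B mB; exact: normal_probN.
  - by apply: eq_integrable (iYX k) => // w _; rewrite /X mulrA.
pose G w := Y w ^+ 2 + (2 * (\sum_k Y w * X k w) + K%:R * \sum_k X k w ^+ 2).
have ZG w : Z w ^+ 2 <= G w.
  rewrite /Z /G sqrrD -addrA lerD2l -mulr_sumr mulrA -mulrnAl mulr2n.
  by rewrite [X in X * _ + _]mulr_natl mulr2n lerD2l sqr_sum_le.
have isum1 : P.-integrable [set: Omega] (fun w => \sum_k (Y w * X k w)%:E)%E.
  exact: integrable_sum.
have isum2 : P.-integrable [set: Omega] (fun w => \sum_k (X k w ^+ 2)%:E)%E.
  exact: integrable_sum.
have GE : (fun w => (G w)%:E) = (fun w => ((Y w ^+ 2)%:E +
    (2%:E * (\sum_k (Y w * X k w)%:E) + K%:R%:E * \sum_k (X k w ^+ 2)%:E))%E).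
  by apply/funext => w; rewrite /G !EFinD !EFinM -!sumEFin.
have i1 := integrableZl measurableT 2 isum1.
have i2 := integrableZl measurableT K%:R isum2.
have i12 := integrableD measurableT i1 i2.
have iG : P.-integrable [set: Omega] (fun w => (G w)%:E).
  rewrite GE; exact: integrableD.
have iZ : P.-integrable [set: Omega] (fun w => (Z w ^+ 2)%:E).
  apply: le_integrable iG => //.
  - apply/measurable_EFinP; apply: (measurable_funX 2); apply: measurable_funD => //.
    by apply: measurable_sum => k; exact: mX.
  - by move=> w _; rewrite lee_fin !ger0_norm ?sqr_ge0// (le_trans _ (ZG w))// sqr_ge0.
split=> //.
apply: (@le_trans _ _ (\int[P]_w (G w)%:E)%E).
  apply: le_integral => // w _; exact: ZG.
rewrite GE integralD//; apply: leeD => //.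
rewrite (integralD measurableT i1 i2) !integralZl// !integral_sum//.
rewrite big1 ?mule0 ?add0e//.
under [in leRHS]eq_integral do rewrite -sumEFin.
rewrite integral_sum//.
rewrite (mulrC 8) -mulrA EFinM -muleA; apply: lee_wpmul2l; first by rewrite lee_fin.
rewrite ge0_sume_distrr; last first.
  by move=> k _; apply: integral_ge0 => w _; rewrite lee_fin sqr_ge0.
by apply: lee_sum => k _; exact: Xle.
Qed.

End SimpleIntegral.

(** * Simple integrals along a deterministic grid, and their tail estimate *)

Section SimpleIntegral.
Context (R : realType) (d : measure_display) (Omega : measurableType d).
Context (P : probability Omega R) (h : \bar R).
Context (F : R -> set (set Omega)) (hF : filtration h F).
Context (K : nat) (W : process R Omega K 1) (hW : wiener_process P h F W).
Context (n : nat) (s : nat -> R).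
Hypothesis Ts : forall i, (i <= n)%N -> time_set h (s i).
Hypothesis s_le : forall i, (i < n)%N -> s i <= s i.+1.

Implicit Type xi : nat -> 'I_K -> Omega -> R.

Definition discrete_integral xi (j : nat) (w : Omega) : R :=
  \sum_(i < j) \sum_k xi i k w * (W (s i.+1) w k 0 - W (s i) w k 0).

Definition discrete_variation xi (j : nat) (w : Omega) : R :=
  \sum_(i < j) \sum_k xi i k w ^+ 2 * (s i.+1 - s i).

(** The grid will be [min (tau i) t]. Beyond the horizon t the coefficient is only known at time tau
    i > t, not at the capped time; but then the step has length 0, so measurability is asked only of
    steps of positive length. *)
Definition predictable xi := forall i k, (i < n)%N -> s i < s i.+1 ->
  measurable_fun [set: g_sigma_algebraType (F (s i))]
    (xi i k : g_sigma_algebraType (F (s i)) -> R).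

Definition bounded_by (C : R) xi := forall i k w, (i < n)%N -> `|xi i k w| <= C.

Lemma discrete_integralS xi j w : discrete_integral xi j.+1 w =
  discrete_integral xi j w + \sum_k xi j k w * (W (s j.+1) w k 0 - W (s j) w k 0).
Proof. by rewrite /discrete_integral big_ord_recr. Qed.

Lemma discrete_variationS xi j w : discrete_variation xi j.+1 w =
  discrete_variation xi j w + \sum_k xi j k w ^+ 2 * (s j.+1 - s j).
Proof. by rewrite /discrete_variation big_ord_recr. Qed.

Lemma discrete_integral_stationary xi j : s j = s j.+1 ->
  discrete_integral xi j.+1 = discrete_integral xi j.
Proof.
move=> sE; apply/funext => w; rewrite discrete_integralS big1 ?addr0// => k _.
by rewrite sE subrr mulr0.
Qed.

Lemma discrete_variation_stationary xi j : s j = s j.+1 ->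
  discrete_variation xi j.+1 = discrete_variation xi j.
Proof.
move=> sE; apply/funext => w; rewrite discrete_variationS big1 ?addr0// => k _.
by rewrite sE subrr mulr0.
Qed.

Lemma discrete_variation_ge0 xi j w : (j <= n)%N -> 0 <= discrete_variation xi j w.
Proof.
move=> jn; apply: sumr_ge0 => i _; apply: sumr_ge0 => k _.
by rewrite mulr_ge0 ?sqr_ge0// subr_ge0 s_le// (leq_trans _ jn).
Qed.

Lemma measurable_discrete_integral xi j : predictable xi -> (j <= n)%N ->
  measurable_fun [set: g_sigma_algebraType (F (s j))]
    (discrete_integral xi j : g_sigma_algebraType (F (s j)) -> R).
Proof.
move=> mxi; elim: j => [|j IH] jn.
  rewrite (_ : discrete_integral xi 0 = cst 0)//.
  by apply/funext => w; rewrite /discrete_integral big_ord0.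
have [sE|sE] := eqVneq (s j) (s j.+1).
  by rewrite discrete_integral_stationary// -sE; apply: IH; exact: ltnW.
have st : s j < s j.+1 by rewrite lt_neqAle sE s_le.
have Tj := Ts (ltnW jn); have Tj1 := Ts jn.
have -> : discrete_integral xi j.+1 = fun w => discrete_integral xi j w +
    \sum_k xi j k w * (W (s j.+1) w k 0 - W (s j) w k 0).
  by apply/funext => w; rewrite discrete_integralS.
apply: measurable_funD.
  by apply: (filtration_mono_measurable_fun hF Tj Tj1 (ltW st)); exact: IH (ltnW jn).
apply: measurable_sum => k; apply: measurable_funM.
  by apply: (filtration_mono_measurable_fun hF Tj Tj1 (ltW st)); exact: mxi.
apply: measurable_funB; first exact: (wiener_measurable hF hW).
by apply: (filtration_mono_measurable_fun hF Tj Tj1 (ltW st)); exact: (wiener_measurable hF hW).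
Qed.

(** The variation through step j is known when that step begins, since its last coefficient is, and
    the step lengths are deterministic. Hence a truncation decided by it stays predictable. *)
Lemma predictable_discrete_variation xi j : predictable xi -> (j < n)%N ->
  measurable_fun [set: g_sigma_algebraType (F (s j))]
    (discrete_variation xi j.+1 : g_sigma_algebraType (F (s j)) -> R).
Proof.
move=> mxi.
have step i : (i < n)%N ->
    measurable_fun [set: g_sigma_algebraType (F (s i))]
      (discrete_variation xi i : g_sigma_algebraType (F (s i)) -> R) ->
    measurable_fun [set: g_sigma_algebraType (F (s i))]
      (discrete_variation xi i.+1 : g_sigma_algebraType (F (s i)) -> R).
  move=> iN IH; have [sE|sE] := eqVneq (s i) (s i.+1).
    by rewrite discrete_variation_stationary.
  have st : s i < s i.+1 by rewrite lt_neqAle sE s_le.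
  have -> : discrete_variation xi i.+1 = fun w => discrete_variation xi i w +
      \sum_k xi i k w ^+ 2 * (s i.+1 - s i).
    by apply/funext => w; rewrite discrete_variationS.
  apply: measurable_funD => //; apply: measurable_sum => k.
  by apply: measurable_funM => //; apply: (measurable_funX 2); exact: mxi.
elim: j => [|j IH] jn; apply: step => //.
  rewrite (_ : discrete_variation xi 0 = cst 0)//.
  by apply/funext => w; rewrite /discrete_variation big_ord0.
apply: (filtration_mono_measurable_fun hF (Ts (ltnW (ltnW jn))) (Ts (ltnW jn))
  (s_le (ltnW jn))).
exact: IH (ltnW jn).
Qed.

Lemma measurable_discrete_variation xi j : predictable xi -> (j <= n)%N ->
  measurable_fun [set: Omega] (discrete_variation xi j).
Proof.
case: j => [|j] mxi jn.
  rewrite (_ : discrete_variation xi 0 = cst 0)//.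
  by apply/funext => w; rewrite /discrete_variation big_ord0.
apply: (filtration_measurable_fun hF (Ts (ltnW jn))).
exact: predictable_discrete_variation.
Qed.

(** Induction on the number of steps: the integral so far is the [Y] of [step_second_moment], and a
    step of length 0 changes neither side. *)
Lemma discrete_second_moment xi (C : R) j : predictable xi -> bounded_by C xi ->
  (j <= n)%N ->
  P.-integrable [set: Omega] (fun w => (discrete_integral xi j w ^+ 2)%:E) /\
  (\int[P]_w (discrete_integral xi j w ^+ 2)%:E <=
    (8 * K%:R)%:E * \int[P]_w (discrete_variation xi j w)%:E)%E.
Proof.
move=> mxi xiC; elim: j => [|j IH] jn.
  have -> : (fun w => (discrete_integral xi 0 w ^+ 2)%:E) = cst 0%E.
    by apply/funext => w; rewrite /discrete_integral big_ord0 expr0n.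
  split; first exact: integrable0.
  rewrite integral0 mule_ge0 ?lee_fin//; apply: integral_ge0 => w _.
  by rewrite lee_fin discrete_variation_ge0.
have [iYj leYj] := IH (ltnW jn).
have [sE|sE] := eqVneq (s j) (s j.+1).
  by rewrite discrete_integral_stationary// discrete_variation_stationary.
have st : s j < s j.+1 by rewrite lt_neqAle sE s_le.
have Tj := Ts (ltnW jn); have Tj1 := Ts jn.
have mY := measurable_discrete_integral mxi (ltnW jn).
have -> : (fun w => (discrete_integral xi j.+1 w ^+ 2)%:E) =
    (fun w => ((discrete_integral xi j w +
      \sum_k xi j k w * (W (s j.+1) w k 0 - W (s j) w k 0)) ^+ 2)%:E).
  by apply/funext => w; rewrite discrete_integralS.
have [iY leY] := step_second_moment hF hW Tj Tj1 st mY iYj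
  (fun k => mxi j k jn st) (fun k w => xiC j k w jn).
split => //; apply: le_trans leY _.
have -> : (\int[P]_w (discrete_variation xi j.+1 w)%:E =
    \int[P]_w (discrete_variation xi j w)%:E +
    (s j.+1 - s j)%:E * \int[P]_w (\sum_k xi j k w ^+ 2)%:E)%E.
  have msum : measurable_fun [set: Omega] (fun w => \sum_k xi j k w ^+ 2).
    apply: measurable_sum => k; apply: (measurable_funX 2).
    by apply: (filtration_measurable_fun hF Tj); exact: mxi.
  have sum0 w : 0 <= \sum_k xi j k w ^+ 2.
    by apply: sumr_ge0 => k _; exact: sqr_ge0.
  rewrite -ge0_integralZl//; first last.
  - by rewrite lee_fin subr_ge0 ltW.
  - by move=> w _; rewrite lee_fin.
  - exact/measurable_EFinP.
  rewrite -ge0_integralD//; first last.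
  - by under eq_fun do rewrite -EFinM; apply/measurable_EFinP; exact: measurable_funM.
  - by move=> w _; rewrite -EFinM lee_fin mulr_ge0// subr_ge0 ltW.
  - by apply/measurable_EFinP; exact: measurable_discrete_variation (ltnW jn).
  - by move=> w _; rewrite lee_fin discrete_variation_ge0// ltnW.
  apply: eq_integral => w _; rewrite discrete_variationS EFinD -EFinM.
  by rewrite -mulr_suml mulrC.
have vj : (0 <= \int[P]_w (discrete_variation xi j w)%:E)%E.
  by apply: integral_ge0 => w _; rewrite lee_fin discrete_variation_ge0// ltnW.
have vs : (0 <= (s j.+1 - s j)%:E * \int[P]_w (\sum_k xi j k w ^+ 2)%:E)%E.
  rewrite mule_ge0 ?lee_fin ?subr_ge0 ?(ltW st)//; apply: integral_ge0 => w _.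
  by rewrite lee_fin; apply: sumr_ge0 => k _; exact: sqr_ge0.
rewrite (ge0_muleDr _ vj vs).
by apply: leeD => //; rewrite muleA -EFinM.
Qed.

(** The second bound drives the induction. At a step that is kept, the truncated variation is below
    the full one, which is at most [delta]; at a step that is cut, nothing is added. *)
Lemma discrete_truncation xi (delta : R) j w : 0 <= delta -> (j <= n)%N ->
  let xi' i k w := if discrete_variation xi i.+1 w <= delta then xi i k w else 0 in
  discrete_variation xi' j w <= delta /\
  discrete_variation xi' j w <= discrete_variation xi j w.
Proof.
move=> delta0 + xi'; elim: j => [|j IH] jn.
  by rewrite /discrete_variation !big_ord0.
have [IH1 IH2] := IH (ltnW jn); rewrite discrete_variationS.
have [le|gt] := leP (discrete_variation xi j.+1 w) delta.
  have le' : discrete_variation xi' j w + \sum_k xi' j k w ^+ 2 * (s j.+1 - s j) <=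
      discrete_variation xi j.+1 w.
    by rewrite discrete_variationS lerD// ler_sum// => k _; rewrite /xi' le.
  by split => //; exact: le_trans le' le.
have -> : \sum_k xi' j k w ^+ 2 * (s j.+1 - s j) = 0.
  by apply: big1 => k _; rewrite /xi' leNgt gt/= expr0n mul0r.
rewrite addr0; split => //; apply: le_trans IH2 _.
rewrite discrete_variationS lerDl sumr_ge0// => k _.
by rewrite mulr_ge0 ?sqr_ge0// subr_ge0 s_le.
Qed.

Lemma discrete_variation_mono xi i j w : (i <= j <= n)%N ->
  discrete_variation xi i w <= discrete_variation xi j w.
Proof.
move=> /andP[ij jn]; elim: j ij jn => [|j IH].
  by rewrite leqn0 => /eqP ->.
rewrite leq_eqVlt => /predU1P[->//|ij] jn.
apply: le_trans (IH ij (ltnW jn)) _.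
rewrite discrete_variationS lerDl sumr_ge0// => k _.
by rewrite mulr_ge0 ?sqr_ge0// subr_ge0 s_le.
Qed.

(* Lenglart-type domination of the integral by its quadratic variation: the
   integrand is stopped before the variation exceeds [delta]. *)
Lemma discrete_integral_tail xi (C delta eps : R) :
  predictable xi -> bounded_by C xi -> 0 < delta -> 0 < eps ->
  (P [set w | (eps <= `|discrete_integral xi n w|)%R] <=
   P [set w | (delta <= discrete_variation xi n w)%R] +
   (8 * K%:R * delta / eps ^+ 2)%:E)%E.
Proof.
move=> mxi xiC delta0 eps0.
pose xi' i k w := if discrete_variation xi i.+1 w <= delta then xi i k w else 0.
have mxi' : predictable xi'.
  move=> i k iN st; apply: measurable_fun_ifT => //; last exact: mxi.
  by apply: measurable_fun_ler => //; exact: predictable_discrete_variation.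
have xi'C : bounded_by C xi'.
  move=> i k w iN; rewrite /xi'; case: ifP => _; first exact: xiC.
  by rewrite normr0 (le_trans _ (xiC i k w iN)).
have [iY leY] := discrete_second_moment mxi' xi'C (leqnn n).
have mI x : predictable x -> measurable_fun [set: Omega] (discrete_integral x n).
  move=> mx; apply: (filtration_measurable_fun hF (Ts (leqnn n))).
  exact: measurable_discrete_integral.
have mtail x : predictable x ->
    measurable [set w | eps <= `|discrete_integral x n w|].
  move=> mx; rewrite -[X in measurable X]setTI.
  have := measurableT_comp (@normr_measurable _ setT) (mI x mx).
  move=> /(_ measurableT `[eps, +oo[%classic (measurable_itv _)).
  by congr measurable; apply/seteqP; split => w /=; rewrite in_itv/= andbT.
have mvar : measurable [set w | (delta <= discrete_variation xi n w)%R].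
  rewrite -[X in measurable X]setTI.
  have := measurable_discrete_variation mxi (leqnn n).
  move=> /(_ measurableT `[delta, +oo[%classic (measurable_itv _)).
  by congr measurable; apply/seteqP; split => w /=; rewrite in_itv/= andbT.
apply: (@le_trans _ _ (P ([set w | (delta <= discrete_variation xi n w)%R] `|`
    [set w | (eps <= `|discrete_integral xi' n w|)%R]))).
  apply: le_measure; rewrite ?inE; [exact: mtail|by apply: measurableU => //; exact: mtail|].
  (* If the full variation stays below [delta], so do all the earlier ones; nothing is cut and the
     two integrals coincide. The rest is Chebyshev's inequality for the truncated integral. *)
  move=> w /= epsI; have [le|gt] := leP delta (discrete_variation xi n w); [by left|right].
  rewrite /= (_ : discrete_integral xi' n w = discrete_integral xi n w)//.
  apply: eq_bigr => i _; apply: eq_bigr => k _; rewrite /xi'.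
  rewrite ifT// (le_trans _ (ltW gt))// discrete_variation_mono//.
  by rewrite leqnn ltn_ord.
apply: le_trans (measureU2 _ _ _) _ => //; first exact: mtail.
rewrite leeD2l//.
have markov : ((eps ^+ 2)%:E * P [set w | (eps <= `|discrete_integral xi' n w|)%R] <=
    \int[P]_w (discrete_integral xi' n w ^+ 2)%:E)%E.
  rewrite -integral_cst//; last exact: mtail.
  apply: (@le_trans _ _ (\int[P]_(w in [set w | (eps <= `|discrete_integral xi' n w|)%R])
      (discrete_integral xi' n w ^+ 2)%:E)%E).
    apply: ge0_le_integral => //.
    - exact: mtail.
    - by move=> w _; rewrite lee_fin sqr_ge0.
    - apply/measurable_EFinP/measurable_funTS; apply: (measurable_funX 2); exact: mI.
    - move=> w /= le; rewrite lee_fin -(real_normK (num_real (discrete_integral _ _ _))).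
      by rewrite lerXn2r ?nnegrE// ltW.
  apply: ge0_subset_integral => //.
  - exact: mtail.
  - by apply/measurable_EFinP; apply: (measurable_funX 2); exact: mI.
  - by move=> w _; rewrite lee_fin sqr_ge0.
have eps2 : 0 < eps ^+ 2 by rewrite exprn_gt0.
rewrite -(@lee_pmul2l _ (eps ^+ 2)%:E)// ?lte_fin//.
apply: le_trans markov _; apply: le_trans leY _.
rewrite -EFinM.
have -> : eps ^+ 2 * (8 * K%:R * delta / eps ^+ 2) = 8 * K%:R * delta.
  by rewrite mulrCA divff ?gt_eqF// mulr1.
rewrite [(8 * K%:R * delta)%:E]EFinM; apply: lee_wpmul2l; first by rewrite lee_fin.
apply: (@le_trans _ _ (\int[P]_w (cst delta%:E w))%E).
  apply: ge0_le_integral => //.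
  - by move=> w _; rewrite lee_fin discrete_variation_ge0.
  - by apply/measurable_EFinP; exact: measurable_discrete_variation.
  - by move=> w _; rewrite lee_fin; have [] := discrete_truncation xi w (ltW delta0) (leqnn n).
by rewrite integral_cst//= [X in (_ * X)%E](@probability_setT _ _ _ P) mule1.
Qed.

End SimpleIntegral.

(** This is where completeness of [P] enters. Convergence in probability evaluates [P] on sets that
    are not known to be measurable; they are compared with measurable ones that differ by a null
    set. *)
Lemma complete_ae_eq_set (R : realType) (d : measure_display)
    (T : measurableType d) (m : {measure set T -> \bar R}) (A B : set T) :
  measure_is_complete m -> measurable B -> {ae m, forall x, A x <-> B x} ->
  measurable A /\ m A = m B.
Proof.
move=> cm mB [N [mN N0 ABN]].
have AB x : ~ N x -> (A x <-> B x).
  by move=> Nx; apply: contrapT => nAB; exact/Nx/ABN.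
have neg C : m.-negligible (C `&` N) by exists N; split=> // x [].
have mm C : measurable (C `&` N) by apply: cm; exact: neg.
have AE : A = (B `\` N) `|` (A `&` N).
  apply/seteqP; split => x.
    by move=> Ax; have [Nx|Nx] := pselect (N x); [right|left; split=> //; apply/(AB x Nx)].
  by move=> [[Bx Nx]|[]//]; apply/(AB x Nx).
have mBN : measurable (B `\` N) by exact: measurableD.
have mA : measurable A by rewrite AE; exact: measurableU.
split=> //; have c0 C : m (C `&` N) = 0%E by apply/negligibleP.
have mE C : measurable C -> m C = m (C `\` N).
  move=> mC; transitivity (m (C `\` N) + m (C `&` N))%E; first exact: measureDI.
  by rewrite c0 adde0.
rewrite (mE A mA) (mE B mB).
congr (m _); apply/seteqP; split => x [Cx Nx]; split => //; exact/(AB x Nx).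
Qed.

Lemma measurable_fun_xsection_domain (d1 d2 d3 : measure_display)
    (T1 : measurableType d1) (T2 : measurableType d2) (T3 : measurableType d3)
    (D : set T2) (f : T1 * T2 -> T3) (x : T1) : measurable D ->
  measurable_fun ([set: T1] `*` D) f -> measurable_fun D (fun y => f (x, y)).
Proof.
move=> mD mf _ B mB.
have mTD : measurable ([set: T1] `*` D) by exact: measurableX.
have := measurable_xsection x (mf mTD B mB).
congr measurable; apply/seteqP; split => y; rewrite /xsection /= inE /=.
  by case=> -[].
by case=> Dy By.
Qed.

(** * The time integral of the square of a step function *)

Section SimpleValue.
Context (R : realType).
Local Notation mu := (@lebesgue_measure R).
Context (n : nat) (tau a : nat -> R) (t : R).
Hypothesis tau_ge0 : forall i, (i <= n)%N -> 0 <= tau i.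
Hypothesis tau_le : forall i, (i < n)%N -> tau i <= tau i.+1.

Let f j (s : R) : R := \sum_(i < j) \1_`]tau i, tau i.+1] s * a i.

(** The first j intervals end at or before [tau j]. So at most one term is nonzero at each time, and
    the square of the sum is the sum of the squares. *)
Let f0 j s : (j <= n)%N -> tau j < s -> f j s = 0.
Proof.
elim: j s => [|j IH] s jn st; first by rewrite /f big_ord0.
rewrite /f big_ord_recr/= -/(f j s) IH ?(ltnW jn) ?(le_lt_trans _ st) ?tau_le//.
by rewrite indicE memNset ?mul0r ?add0r//= in_itv/= leNgt st andbF.
Qed.

Let f_sqr j s : (j <= n)%N ->
  f j s ^+ 2 = \sum_(i < j) \1_`]tau i, tau i.+1] s * a i ^+ 2.
Proof.
elim: j => [|j IH] jn; first by rewrite /f !big_ord0 expr0n.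
rewrite /f big_ord_recr/= -/(f j s) big_ord_recr/= -IH ?(ltnW jn)//.
rewrite indicE; case: (boolP (s \in _)) => sj; last by rewrite !mul0r !addr0.
rewrite f0 ?(ltnW jn)//; last by move: sj; rewrite inE/= in_itv/= => /andP[].
by rewrite expr0n !add0r !mul1r.
Qed.

Lemma integral_step_function_sqr :
  (\int[mu]_(s in `[0%R, t])
     ((\sum_(i < n) \1_`]tau i, tau i.+1] s * a i) ^+ 2)%:E)%E =
  (\sum_(i < n) a i ^+ 2 * (Num.min (tau i.+1) t - Num.min (tau i) t))%:E.
Proof.
under eq_integral do rewrite (f_sqr _ (leqnn n)) -sumEFin.
rewrite ge0_integral_sum//; first last.
- by move=> i s _; rewrite lee_fin mulr_ge0// sqr_ge0.
- move=> i; apply/measurable_EFinP/measurable_funM => //.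
rewrite -sumEFin; apply: eq_bigr => i _.
under eq_integral do rewrite mulrC EFinM.
rewrite ge0_integralZl//; [|exact/measurable_EFinP|by rewrite lee_fin sqr_ge0].
rewrite integral_indic//.
(* Cutting at t caps both endpoints; cutting at 0 changes nothing, since the grid times are
   nonnegative. *)
have -> : `]tau i, tau i.+1] `&` `[0, t] =
          `]Num.min (tau i) t, Num.min (tau i.+1) t]%classic.
  apply/seteqP; split => s /=; rewrite !in_itv/= gt_min le_min.
    by move=> [/andP[-> ->] /andP[_ ->]].
  move=> /andP[/orP[ts|ts] /andP[-> st]]; last by move: ts; rewrite ltNge st.
  by rewrite ts st (le_trans _ (ltW ts))// tau_ge0// ltnW.
rewrite [X in (_ * X)%E]lebesgue_measure_itv/= lte_fin.
rewrite [RHS]EFinM; congr (_ * _)%E; case: ltP => //.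
move=> le; congr EFin; apply/eqP; rewrite eq_sym subr_eq0 eq_le le/=.
by rewrite le_min !ge_min lexx (tau_le (ltn_ord i)) /= orbT.
Qed.

End SimpleValue.

Lemma le_measure_exists (R : realType) (d : measure_display)
    (T : measurableType d) (m : {measure set T -> \bar R}) (I : finType)
    (A : I -> set T) (B : set T) :
  (forall i, measurable (A i)) -> measurable B ->
  (forall x, B x -> exists i, A i x) -> (m B <= \sum_i m (A i))%E.
Proof.
move=> mA mB BA.
have : forall x, B x -> exists2 i, i \in enum I & A i x.
  by move=> x /BA[i Aix]; exists i => //; rewrite mem_enum.
rewrite -big_enum /=; elim: (enum I) B mB {BA} => [|i s IH] B mB BA.
  suff -> : B = set0 by rewrite measure0 big_nil.
  by apply/seteqP; split => x // /BA[].
rewrite big_cons.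
apply: (@le_trans _ _ (m (A i `|` (B `\` A i)))).
  apply: le_measure; rewrite ?inE//; last by move=> x Bx; have [|] := pselect (A i x); [left|right].
  by apply: measurableU => //; exact: measurableD.
apply: le_trans (measureU2 _ _ _) _ => //; first exact: measurableD.
apply: leeD2l; apply: IH; first exact: measurableD.
move=> x [/BA[j]]; rewrite inE => /predU1P[->//|js Ajx _].
by exists j.
Qed.

(** * Vanishing of the Ito integral of a null integrand, at a fixed time *)

Section ItoNull.
Context (R : realType) (d : measure_display) (Omega : measurableType d).
Context (P : probability Omega R) (hP : measure_is_complete P) (h : \bar R).
Context (F : R -> set (set Omega)) (hF : filtration h F).
Context (K : nat) (W : process R Omega K 1) (hW : wiener_process P h F W).
Local Notation mu := (@lebesgue_measure R).

(** This is [discrete_integral_tail] for row [i] on the grid capped at [t], the variation being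
    written as time integrals of squares and split by coordinate. Measurability is part of the
    conclusion, as monotonicity and subadditivity of [P] call for it. *)
Lemma simple_integral_tail m (th : simple_process h F K m) (t : R) (i : 'I_m)
    (delta eps : R) : time_set h t -> 0 < delta -> 0 < eps ->
  let V k w := (\int[mu]_(s in `[0%R, t]) ((simple_value th s w i k) ^+ 2)%:E)%E in
  [/\ forall k a, measurable [set w | (a <= V k w)%E],
      measurable_fun [set: Omega] (fun w => simple_integral W th t w i 0) &
     (P [set w | (eps <= `|simple_integral W th t w i 0|)%R] <=
     (\sum_k P [set w | (delta / K.+1%:R)%:E <= V k w]) +
      (8 * K%:R * delta / eps ^+ 2)%:E)%E].
Proof.
move=> Tt delta0 eps0; case: th => [n tau coef Htau tau_le mcoef [C coefC]] /=.
rewrite /simple_value /simple_integral /=.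
pose s j := Num.min (tau j) t.
pose xi j k w : R := coef j w i k.
have t0 : 0 <= t by case: Tt.
have tau0 j : (j <= n)%N -> 0 <= tau j by move=> /Htau[].
have Ts j : (j <= n)%N -> time_set h (s j).
  by move=> jn; rewrite /s; case: leP => _ //; exact: Htau.
have s_le j : (j < n)%N -> s j <= s j.+1.
  move=> jn; rewrite /s le_min !ge_min lexx orbT/= andbT.
  by rewrite (tau_le _ jn).
have mxi : predictable F n s xi.
  move=> j k jn st.
  (* A step of positive length is not capped at its left end: if t <= tau j, both ends equal t. *)
  have -> : s j = tau j.
    rewrite /s; case: leP => // /ltW tle; move: st.
    by rewrite /s (min_r tle) ltNge ge_min lexx orbT.
  apply/(measurable_fun_filtrationP hF); first exact: Htau (ltnW jn).
  by move=> B mB; exact: mcoef.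
have xiC : bounded_by n C xi by move=> j k w jn; exact: coefC.
pose v k w := \sum_(j < n) xi j k w ^+ 2 * (s j.+1 - s j).
have VE k w : (\int[mu]_(u in `[0%R, t]) (((\sum_(j < n)
    \1_`]tau j, tau j.+1] u *: coef j w) i k) ^+ 2)%:E = (v k w)%:E)%E.
  rewrite -(@integral_step_function_sqr R n tau (fun j => xi j k w) t tau0 tau_le).
  apply: eq_integral => u _; rewrite summxE; congr (_ ^+ 2)%:E.
  by apply: eq_bigr => j _; rewrite mxE.
have IE w : (\sum_(j < n) coef j w *m (W (s j.+1) w - W (s j) w)) i 0 =
    discrete_integral W s xi n w.
  rewrite summxE; apply: eq_bigr => j _; rewrite !mxE; apply: eq_bigr => k _.
  by rewrite !mxE.
have mv k : measurable_fun [set: Omega] (v k).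
  apply: measurable_sum => j.
  have [sE|sE] := eqVneq (s j) (s j.+1).
    rewrite sE subrr; under eq_fun do rewrite mulr0; exact: measurable_cst.
  have st : s j < s j.+1 by rewrite lt_neqAle sE s_le.
  apply: measurable_funM => //; apply: (measurable_funX 2).
  apply: (filtration_measurable_fun hF (Ts j (ltnW (ltn_ord j)))).
  exact: mxi.
have mV k a : measurable [set w | (a <= (v k w)%:E)%E].
  rewrite -[X in measurable X]setTI; apply: emeasurable_fun_c_infty => //.
  exact/measurable_EFinP.
have mI : measurable_fun [set: Omega] (discrete_integral W s xi n).
  apply: (filtration_measurable_fun hF (Ts n (leqnn n))).
  exact: (measurable_discrete_integral hF hW Ts s_le mxi (leqnn n)).
split.
- by move=> k a; under eq_set do rewrite VE; exact: mV.
- by under eq_fun do rewrite IE.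
under eq_set do rewrite IE.
apply: le_trans (discrete_integral_tail hF hW Ts s_le mxi xiC delta0 eps0) _.
apply: leeD2r.
under eq_bigr => k _ do under eq_set do rewrite VE.
apply: le_measure_exists => //.
- rewrite (_ : mkset _ = [set w | (delta%:E <= (discrete_variation s xi n w)%:E)%E]).
    rewrite -[X in measurable X]setTI; apply: emeasurable_fun_c_infty => //.
    by apply/measurable_EFinP; exact: (measurable_discrete_variation hF Ts s_le mxi (leqnn n)).
  by apply/seteqP; split => w /=; rewrite lee_fin.
move=> w /= dle; apply: contrapT => /forallNP nex; move: dle.
apply/negP; rewrite -ltNge /discrete_variation exchange_big /=.
(* With [K.+1] shares instead of [K] the total stays strictly below [delta], also for [K = 0]. *)
apply: (@le_lt_trans _ _ (\sum_(k < K) (delta / K.+1%:R))).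
  apply: ler_sum => k _; rewrite leNgt; apply/negP => lt; apply: (nex k).
  by rewrite lee_fin ltW.
rewrite sumr_const card_ord -[ltLHS]mulr_natr -mulrA gtr_pMr//.
by rewrite mulrC ltr_pdivrMr ?ltr0n// mul1r ltr_nat.
Qed.

Lemma ae_time_section (Q : R -> Omega -> Prop) : almost_everywhere_time P h Q ->
  {ae P, forall w, {ae mu, forall t, time_set h t -> Q t w}}.
Proof. exact: (@ae_xsection _ _ _ _ _ P mu (fun w t => time_set h t -> Q t w)). Qed.

Lemma measurable_path m n (X : process R Omega m n) i j w :
  adapted_measurable h F X -> measurable_fun (time_set h) (fun t => X t w i j).
Proof.
move=> [_ mX].
exact: (measurable_fun_xsection_domain (f := fun z => X z.2 z.1 i j) w
  (measurable_time_set h) (mX i j)).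
Qed.

Lemma measurable_simple_path m (th : simple_process h F K m) w i k :
  measurable_fun [set: R] (fun s => simple_value th s w i k).
Proof.
rewrite /simple_value; under eq_fun do rewrite summxE.
apply: measurable_sum => j; under eq_fun do rewrite mxE.
by apply: measurable_funM.
Qed.

(** If |I| >= 2 eps, then either I is at least eps away from the n-th simple integral or the latter
    is at least eps in size. The first event becomes improbable by definition of the Ito integral.
    So does the second up to a term linear in delta, because the variation of the n-th simple
    process is almost surely its distance to the null integrand. First n grows, then delta
    shrinks. *)
Lemma ito_integral_null_at m (th : process R Omega m K) (I : process R Omega m 1)
    (t : R) (i : 'I_m) :
  adapted_measurable h F th -> ito_integral P h F W th I ->
  almost_everywhere_time P h (fun t w => th t w = 0) -> time_set h t ->
  {ae P, forall w, I t w i 0 = 0}.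
Proof.
move=> mth [aI _ [thn Hthn]] th0 Tt; have [H1 H2] := Hthn t Tt.
have mI : measurable_fun [set: Omega] (fun w => I t w i 0).
  apply: (filtration_measurable_fun hF Tt).
  by apply/(measurable_fun_filtrationP hF) => // B mB; exact: aI.
have mge (f : Omega -> R) (e : R) : measurable_fun [set: Omega] f ->
    measurable [set w | (e <= `|f w|)%R].
  move=> mf; rewrite -[X in measurable X]setTI.
  have := measurableT_comp (@normr_measurable _ setT) mf.
  move=> /(_ measurableT `[e, +oo[%classic (measurable_itv _)).
  by congr measurable; apply/seteqP; split => w /=; rewrite in_itv/= andbT.
have lt_near (X : nat -> Omega -> \bar R) (e eps : R) : 0 < e -> 0 < eps ->
    cvg0_in_probability P X ->
    \forall n \near \oo, (P [set w | (eps%:E <= X n w)%E] <= e%:E)%E.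
  move=> e0 eps0 /(_ _ eps0) /(_ [set x | (x <= e%:E)%E]); apply.
  apply: (@filterS _ _ _ [set x | x < e%:E]%E).
    by move=> x /= /ltW.
  apply: open_nbhs_nbhs; split; last by rewrite /= lte_fin.
  exact: open_ereal_lt_ereal.
have tail (eps : R) : 0 < eps -> P [set w | (2 * eps <= `|I t w i 0|)%R] = 0%E.
  move=> eps0; apply/eqP; rewrite eq_le measure_ge0 andbT.
  apply/lee_addgt0Pr => e e0; rewrite add0e.
  (* Makes 8 K delta / eps^2 at most e; the summand 1 keeps the denominator positive when
     [K = 0]. *)
  pose delta := e * eps ^+ 2 / (8 * K%:R + 1).
  have K1 : 0 < 8 * K%:R + 1 :> R by rewrite ltr_wpDl// mulr_ge0.
  have delta0 : 0 < delta by rewrite divr_gt0// mulr_gt0// exprn_gt0.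
  apply: (@le_trans _ _ (8 * K%:R * delta / eps ^+ 2)%:E); last first.
    rewrite lee_fin /delta.
    have -> : 8 * K%:R * (e * eps ^+ 2 / (8 * K%:R + 1)) / eps ^+ 2 =
        e * (8 * K%:R / (8 * K%:R + 1)).
      by field; rewrite !gt_eqF.
    by rewrite ler_piMr ?(ltW e0)// ler_pdivrMr// mul1r lerDl.
  apply/lee_addgt0Pr => e' e'0.
  (* One share for the distance to I, and one for each of the K coordinates of the variation. *)
  pose eta := e' / K.+1%:R.
  have eta0 : 0 < eta by rewrite divr_gt0.
  have dK0 : 0 < delta / K.+1%:R by rewrite divr_gt0.
  have near1 := lt_near _ _ _ eta0 eps0 (H2 i).
  have near2 : \forall n \near \oo, forall k, (P [set w |
      ((delta / K.+1%:R)%:E <= \int[mu]_(s in `[0%R, t])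
            ((simple_value (thn n) s w i k - th s w i k) ^+ 2)%:E)] <= eta%:E)%E.
    by apply: filter_forall => k; exact: lt_near (H1 i k).
  have [n [lt1 lt2]] := filter_ex (filterI near1 near2).
  have [mV mS le] := simple_integral_tail (thn n) i Tt delta0 eps0.
  apply: (@le_trans _ _ (P (
      [set w | (eps <= `|simple_integral W (thn n) t w i 0 - I t w i 0|)%R]
      `|` [set w | (eps <= `|simple_integral W (thn n) t w i 0|)%R]))).
    apply: le_measure; rewrite ?inE; [exact: mge| |].
      by apply: measurableU; apply: mge => //; exact: measurable_funB.
    move=> w /= leI.
    have [lew|ltw] := leP eps `|simple_integral W (thn n) t w i 0|; [by right|left].
    rewrite distrC; have := lerB_dist (I t w i 0) (simple_integral W (thn n) t w i 0).
    by rewrite /=; lra.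
  apply: le_trans (measureU2 _ _ _) _; [apply: mge; exact: measurable_funB|exact: mge|].
  have lt1' : (P [set w |
      (eps <= `|simple_integral W (thn n) t w i 0 - I t w i 0|)%R] <= eta%:E)%E.
    by apply: le_trans lt1; rewrite le_eqVlt; apply/orP; left; apply/eqP; congr (P _);
      apply/seteqP; split => w /=; rewrite lee_fin.
  have -> : (8 * K%:R * delta / eps ^+ 2)%:E + e'%:E =
      (eta%:E + ((K%:R * eta)%:E + (8 * K%:R * delta / eps ^+ 2)%:E))%E.
    by rewrite -!EFinD /eta; congr EFin; rewrite -natr1; field; rewrite nat1r !gt_eqF.
  apply: leeD => //; apply: le_trans le _; apply: leeD => //.
  apply: (@le_trans _ _ (\sum_(k < K) eta%:E)%E); last first.
    by rewrite sumEFin sumr_const card_ord mulr_natl.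
  apply: lee_sum => k _; apply: le_trans (lt2 k).
  (* On almost every path [th] is null at almost all times, so the two integrals agree. Only the
     event without [th] is known to be measurable; completeness gives the other one the same
     probability. *)
  rewrite le_eqVlt; apply/orP; left; apply/eqP/esym.
  apply: (proj2 (complete_ae_eq_set hP (mV k _) _)).
  have := ae_time_section th0; apply: filterS => w thw /=.
  suff -> : (\int[mu]_(s in `[0%R, t])
      ((simple_value (thn n) s w i k - th s w i k) ^+ 2)%:E)%E =
    (\int[mu]_(s in `[0%R, t]) (simple_value (thn n) s w i k ^+ 2)%:E)%E by [].
  have msub : `[0, t] `<=` time_set h by exact: sub_itv_time_set.
  apply: ge0_ae_eq_integral => //.
  - apply/measurable_EFinP; apply: (measurable_funX 2); apply: measurable_funB.
      by apply: measurable_funTS; exact: measurable_simple_path.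
    apply: measurable_funS msub _; first exact: measurable_time_set.
    exact: measurable_path.
  - apply/measurable_EFinP; apply: (measurable_funX 2).
    by apply: measurable_funTS; exact: measurable_simple_path.
  - by move=> s _; rewrite lee_fin sqr_ge0.
  - by move=> s _; rewrite lee_fin sqr_ge0.
  - move: thw; apply: filterS; first exact: (ae_filter_ringOfSetsType mu).
    by move=> s ths /msub /ths ->; rewrite mxE subr0.
have : {ae P, forall w, forall n, ~ (2 * (n.+1%:R^-1) <= `|I t w i 0|)%R}.
  apply: ae_foralln => n; exists [set w | (2 * n.+1%:R^-1 <= `|I t w i 0|)%R].
  split; [exact: mge|by apply: tail; rewrite invr_gt0|].
  by move=> w /= /contrapT.
apply: filterS => w Iw; apply/eqP; rewrite -normr_le0; apply/ler_addgt0Pr => e e0.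
rewrite add0r.
have e20 : 0 <= 2 / e by rewrite divr_ge0// ltW.
have := archi_boundP e20; set n := Num.bound _ => ltn.
have /negP := Iw n; rewrite -ltNge => /ltW/le_trans; apply.
rewrite ler_pdivrMr// mulrC -ler_pdivrMr// (le_trans (ltW ltn))//.
by rewrite ler_nat.
Qed.

End ItoNull.

(** A nonzero value at t > 0 would persist at nearby times. The rational is chosen to the left of t,
    because t may be the right end of the time interval; the time 0 is itself rational. *)
Lemma continuous_rat_eq0 (R : realType) (h : \bar R) (f : R -> R) :
  {within time_set h, continuous f} ->
  (forall q : rat, time_set h (ratr q) -> f (ratr q) = 0) ->
  forall t, time_set h t -> f t = 0.
Proof.
move=> /subspace_continuousP cf f0 t Tt; apply: contrapT => /eqP ft0.
have t0 : 0 < t.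
  have [t_ge0 _] := Tt; rewrite lt_neqAle t_ge0 andbT eq_sym.
  apply: contra ft0 => /eqP tE; rewrite tE -(rmorph0 (@ratr R)) f0 rmorph0 ?eqxx//.
  exact: (time_set_sub (lexx 0) t_ge0 Tt).
have [e /= e0 He] := cvgr_neq0 _ (cf t Tt) ft0.
have [|q] := @rat_in_itvoo R (Num.max 0 (t - e)) t.
  by rewrite gt_max t0/= ltrBlDr ltrDl.
rewrite in_itv/= gt_max => /andP[/andP[q0 qe] qt].
have Tq : time_set h (ratr q) by apply: (time_set_sub (ltW q0) (ltW qt)).
have /= := He (ratr q).
rewrite /from_subspace f0 ?eqxx // => nq; apply: notF; apply: nq => //.
by rewrite ger0_norm ?subr_ge0 ?(ltW qt)// ltrBlDr -ltrBlDl.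
Qed.

Section ItoNull.
Context (R : realType) (d : measure_display) (Omega : measurableType d).
Context (P : probability Omega R) (hP : measure_is_complete P) (h : \bar R).
Context (F : R -> set (set Omega)) (hF : filtration h F).
Context (K : nat) (W : process R Omega K 1) (hW : wiener_process P h F W).

Lemma ae_forall_rat (Q : rat -> Omega -> Prop) :
  (forall q, {ae P, forall w, Q q w}) -> {ae P, forall w, forall q, Q q w}.
Proof.
move=> aeQ.
have : {ae P, forall w, forall n, forall q : rat, unpickle n = Some q -> Q q w}.
  apply: ae_foralln => n; case: (unpickle n) => [q|]; last exact: aeW.
  by apply: filterS (aeQ q) => w Qw q' [<-].
by apply: filterS => w Qw q; apply: (Qw (pickle q)); rewrite pickleK.
Qed.

(** The null set of [ito_integral_null_at] depends on the time. Those of the rational times are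
    united, and continuity of the paths covers all other times. *)
Lemma ito_integral_null m (th : process R Omega m K) (I : process R Omega m 1) :
  adapted_measurable h F th -> ito_integral P h F W th I ->
  almost_everywhere_time P h (fun t w => th t w = 0) ->
  almost_surely P h (fun t w => I t w = 0).
Proof.
move=> mth itoI th0; have [_ cI _] := itoI.
have : {ae P, forall w, forall q : rat, time_set h (ratr q) ->
    forall i, I (ratr q) w i 0 = 0}.
  apply: ae_forall_rat => q; have [Tq|nTq] := pselect (time_set h (ratr q)).
    have : {ae P, forall w, forall i, I (ratr q) w i 0 = 0}.
      by apply: filter_forall => i; exact: (ito_integral_null_at hP hF hW i mth itoI th0 Tq).
    by apply: filterS => w Iw _.
  by apply: aeW => w.
move: cI; apply: filterS2 => w cIw Iw t Tt.
apply/matrixP => i j; rewrite ord1 mxE.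
apply: (@continuous_rat_eq0 R h (fun t => I t w i 0)) => //.
by move=> q Tq; exact: Iw.
Qed.

End ItoNull.

(** * Lebesgue differentiation and the exponential equation *)

Section LebesgueDifferentiation.
Context (R : realType).
Local Notation mu := (@lebesgue_measure R).

(** Cutting [f] off outside [[0, u]] makes it integrable on the whole line, as the fundamental
    theorem is used here; at interior points the cut-off is not felt. *)
Lemma ae_is_derive_integral (f : R -> R) (u : R) :
  mu.-integrable `[0, u] (EFin \o f) ->
  {ae mu, forall x, x \in `]0, u[ ->
    is_derive x 1 (fun y => \int[mu]_(s in `[0, y]) ((f \_ `[0, u]) s)) (f x)}.
Proof.
move=> fi; have floc := integrable_locally (measurable_itv _) fi.
have ig : mu.-integrable [set: R] (EFin \o (f \_ `[0, u])).
  by move: fi; rewrite integrable_mkcond//= restrict_EFin.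
have ig' y : mu.-integrable [set` Interval (BLeft 0) (BRight y)] (EFin \o (f \_ `[0, u])).
  exact: integrableS ig.
have := FTC1 ig' floc; apply: filterS; first exact: (ae_filter_ringOfSetsType mu).
move=> x + /[!in_itv]/= /andP[x0 xu].
case; first by rewrite /= lte_fin.
move=> dx dE.
apply: DeriveDef => //.
by rewrite -derive1E dE patchE mem_set//= in_itv/= !ltW.
Qed.

Lemma Rintegral_restrict_itv (f : R -> R) (u y : R) :
  \int[mu]_(s in `[0, y]) ((f \_ `[0, u]) s) =
  \int[mu]_(s in `[0, Num.min y u]) f s.
Proof.
rewrite -Rintegral_mkcondr; congr Rintegral; apply/seteqP; split => s /=.
  by rewrite !in_itv/= le_min => -[/andP[-> ->] /andP[_ ->]].
by rewrite !in_itv/= le_min => /andP[-> /andP[-> ->]].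
Qed.

Lemma ae_exponential_ode (h : \bar R) (M r p : R -> R) :
  (forall t, time_set h t -> mu.-integrable `[0, t] (EFin \o r)) ->
  (forall t, time_set h t -> mu.-integrable `[0, t] (EFin \o p)) ->
  (forall t, time_set h t -> M t = M 0 * expR (\int[mu]_(s in `[0, t]) r s)) ->
  (forall t, time_set h t -> M t = M 0 + \int[mu]_(s in `[0, t]) p s) ->
  {ae mu, forall t, time_set h t -> p t = r t * M t}.
Proof.
move=> ri pi_ Mr Mp.
have main u : time_set h u -> {ae mu, forall x, x \in `]0, u[ -> p x = r x * M x}.
  move=> Tu; have dr := ae_is_derive_integral (ri u Tu).
  have dp := ae_is_derive_integral (pi_ u Tu).
  move: dr dp; apply: filterS2; first exact: (ae_filter_ringOfSetsType mu).
  move=> x + + xu => /(_ xu) dr /(_ xu) dp.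
  have Tx : time_set h x.
    move: xu; rewrite in_itv/= => /andP[x0 xu].
    exact: (time_set_sub (ltW x0) (ltW xu) Tu).
  set Ir := (fun y => _) in dr; set Ip := (fun y => _) in dp.
  (* Derivatives are taken on the real line, so the identity is extended to all y: both sides equal
     M 0 for y < 0 and are frozen at their value in u for y > u. *)
  have E : M 0 \*: (expR \o Ir) = cst (M 0) + Ip.
    apply/funext => y; rewrite /= /Ir /Ip !fctE /= !Rintegral_restrict_itv.
    have [y0|y0] := leP 0 y.
      have Ty : time_set h (Num.min y u).
        apply: (fun H1 H2 => time_set_sub H1 H2 Tu); last by rewrite ge_min lexx orbT.
        by rewrite le_min y0; case: Tu.
      exact: etrans (esym (Mr _ Ty)) (Mp _ Ty).
    rewrite (_ : `[0, Num.min y u]%classic = set0) ?Rintegral_set0.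
      by rewrite expR0 addr0 /GRing.scale/= mulr1.
    apply/seteqP; split => s //=; rewrite in_itv/= le_min => /andP[s0 /andP[sy _]].
    by move: (le_trans s0 sy); rewrite leNgt y0.
  have d1 : is_derive x 1 (M 0 \*: (expR \o Ir)) (M 0 *: (expR (Ir x) * r x)).
    by apply: is_deriveZ; apply: is_derive1_comp.
  have d2 : is_derive x 1 (cst (M 0) + Ip) (0 + p x) by apply: is_deriveD.
  have := @derive_val _ _ _ _ _ _ _ d1; rewrite E (@derive_val _ _ _ _ _ _ _ d2) add0r => ->.
  rewrite (Mr x Tx) /GRing.scale/= mulrA mulrC /Ir Rintegral_restrict_itv min_l; first by ring.
  by move: xu; rewrite in_itv/= => /andP[_ /ltW].
have ne c : {ae mu, forall t, t != c}.
  exists [set c]; split => //; first exact: lebesgue_measure_set1.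
  by move=> t /= /negP; rewrite negbK => /eqP.
(* Countably many intervals []0, v n[] exhaust the time interval up to the points 0 and [fine h].
   The latter is T for a finite horizon and 0 for an infinite one, so only null sets are lost. *)
have [v Tv vP] : exists2 u : nat -> R, forall n, 0 < u n -> time_set h (u n) &
    forall t, time_set h t -> t != fine h -> exists n, t < u n.
  case: h {ri pi_ Mr Mp main} => [c| |].
  - exists (fun=> c) => [_ c0|t [t0 tc] tnc]; first by split; rewrite ?lexx ?ltW.
    by exists 0%N; rewrite lt_neqAle -lee_fin tc andbT.
  - exists (fun n => n%:R) => [n n0|t [t0 _] _]; first by split; rewrite ?leey ?ltW.
    by exists (Num.bound t); exact: archi_boundP.
  - by exists (fun=> 0) => [n|t []]; rewrite ?ltxx// leeNy_eq.
have : {ae mu, forall x, forall n, x \in `]0, v n[ -> p x = r x * M x}.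
  apply: ae_foralln => n; have [un0|un0] := ltP 0 (v n).
    exact: main (Tv n un0).
  apply: aeW => x; rewrite in_itv/= => /andP[x0 /(lt_trans x0)].
  by rewrite ltNge un0.
move: (ne 0) (ne (fine h)); apply: filterS3.
move=> t t0 th tP Tt; have [n tn] := vP t Tt th.
apply: (tP n); rewrite in_itv/= tn andbT lt_neqAle eq_sym t0.
by case: Tt.
Qed.

End LebesgueDifferentiation.

(** * Product rule for absolutely continuous functions *)

Section ProductRule.
Context (R : realType).
Local Notation mu := (@lebesgue_measure R).

Lemma integrable_cst_itv (b0 b1 : bool) (x y c : R) :
  mu.-integrable [set` Interval (BSide b0 x) (BSide b1 y)] (cst c%:E).
Proof.
apply/integrableP; split => //=.
rewrite integral_cst//= lebesgue_measure_itv/=.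
by case: ifP => _; rewrite ?mule0 ?ltry.
Qed.

Lemma EFin_Rintegral (D : set R) (f : R -> R) : measurable D ->
  mu.-integrable D (EFin \o f) ->
  (\int[mu]_(x in D) (f x)%:E)%E = (\int[mu]_(x in D) f x)%:E.
Proof. by move=> mD fi; rewrite fineK//; exact: integrable_fin_num. Qed.

Local Notation RR := (measurableTypeR R * measurableTypeR R)%type.

Lemma integral_EFinZl (q : R -> R) (c : R) : mu.-integrable [set: R] (EFin \o q) ->
  (\int[mu]_y (c * q y)%:E = (c * \int[mu]_y q y)%:E)%E.
Proof.
move=> qi; rewrite -RintegralZl// EFin_Rintegral//.
by have := integrableZl measurableT c qi; apply: eq_integrable => // y _; rewrite /= EFinM.
Qed.

Lemma integrable_tensor (p g : R -> R) (B : set RR) :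
  mu.-integrable [set: R] (EFin \o p) -> mu.-integrable [set: R] (EFin \o g) ->
  measurable B ->
  (mu \x mu)%E.-integrable [set: RR] (fun z => (p z.1 * g z.2 * \1_B z)%:E).
Proof.
move=> pi_ gi mB.
have mp : measurable_fun [set: R] p by apply/measurable_EFinP; exact: measurable_int pi_.
have mg : measurable_fun [set: R] g by apply/measurable_EFinP; exact: measurable_int gi.
pose H (z : RR) := (p z.1 * g z.2)%:E.
have mH : measurable_fun [set: RR] H.
  apply/measurable_EFinP; apply: measurable_funM; exact: measurableT_comp.
have iH : (mu \x mu)%E.-integrable [set: RR] H.
  apply/integrable12ltyP => //=.
  under eq_integral => x _.
    under eq_integral do rewrite normrM.
    rewrite integral_EFinZl; last exact: integrable_norm gi.
    rewrite mulrC; over.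
  rewrite integral_EFinZl; last exact: integrable_norm pi_.
  exact: ltry.
apply: le_integrable iH => //.
  apply/measurable_EFinP; apply: measurable_funM; first by apply/measurable_EFinP.
  exact: measurable_indic.
move=> z _; rewrite lee_fin normrM ler_piMr// indicE.
by case: (z \in B); rewrite ?normr1 ?normr0.
Qed.

(* Fubini on the square [0, t]^2, cut along its diagonal. *)
Lemma Rintegral_mul (p g : R -> R) (t : R) :
  mu.-integrable `[0, t] (EFin \o p) -> mu.-integrable `[0, t] (EFin \o g) ->
  [/\ mu.-integrable `[0, t] (fun s => (p s * \int[mu]_(u in `[0, s]) g u)%:E),
      mu.-integrable `[0, t] (fun s => (g s * \int[mu]_(u in `[0, s]) p u)%:E) &
      (\int[mu]_(s in `[0, t]) p s) * (\int[mu]_(s in `[0, t]) g s) =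
      \int[mu]_(s in `[0, t]) (p s * \int[mu]_(u in `[0, s]) g u) +
      \int[mu]_(s in `[0, t]) (g s * \int[mu]_(u in `[0, s]) p u)].
Proof.
move=> pi_ gi.
pose p' := p \_ `[0, t]; pose g' := g \_ `[0, t].
have mit : measurable (`[0, t]%classic : set R) by exact: measurable_itv.
have p'i : mu.-integrable [set: R] (EFin \o p').
  by move: pi_; rewrite integrable_mkcond//= restrict_EFin.
have g'i : mu.-integrable [set: R] (EFin \o g').
  by move: gi; rewrite integrable_mkcond//= restrict_EFin.
have mp' : measurable_fun [set: R] p' by apply/measurable_EFinP; exact: measurable_int p'i.
have mg' : measurable_fun [set: R] g' by apply/measurable_EFinP; exact: measurable_int g'i.
pose A : set RR := [set z | z.2 <= z.1].
have mA : measurable A.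
  have := measurable_fun_ler (measurable_snd : measurable_fun [set: RR] snd)
    (measurable_fst : measurable_fun [set: RR] fst).
  move=> /(_ measurableT [set true] I); rewrite setTI.
  by congr measurable; apply/seteqP; split => z.
pose H (z : RR) := (p' z.1 * g' z.2)%:E.
have iH : (mu \x mu)%E.-integrable [set: RR] H.
  have := integrable_tensor p'i g'i measurableT.
  by apply: eq_integrable => // z _; rewrite indicT mulr1.
pose f1 (z : RR) := (p' z.1 * g' z.2 * \1_A z)%:E.
pose f2 (z : RR) := (p' z.1 * g' z.2 * \1_(~` A) z)%:E.
have f1i : (mu \x mu)%E.-integrable [set: RR] f1 by exact: integrable_tensor.
have f2i : (mu \x mu)%E.-integrable [set: RR] f2.
  by apply: integrable_tensor => //; exact: measurableC.
have f12 : (\int[mu \x mu]_z H z = \int[mu \x mu]_z f1 z + \int[mu \x mu]_z f2 z)%E.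
  rewrite -integralD//; apply: eq_integral => z _; rewrite /f1 /f2 /H -EFinD.
  by rewrite !indicE in_setC; case: (z \in A); rewrite /= ?mulr1 ?mulr0 ?addr0 ?add0r.
have IH : (\int[mu \x mu]_z H z =
    ((\int[mu]_(s in `[0, t]) p s)%R * (\int[mu]_(s in `[0, t]) g s)%R)%:E)%E.
  rewrite -integral12_prod_meas1// /fubini_F /H /=.
  under eq_integral => x _ do rewrite integral_EFinZl// mulrC.
  by rewrite integral_EFinZl// mulrC -!Rintegral_mkcond.
have slice (q : R -> R) : mu.-integrable `[0, t] (EFin \o q) ->
    forall B, measurable B -> B `<=` `[0, t] ->
    mu.-integrable [set: R] (EFin \o (q \_ B)).
  move=> qi B mB Bt.
  have : mu.-integrable B (EFin \o q) by apply: integrableS qi.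
  by rewrite integrable_mkcond//= restrict_EFin.
have F1 x : (\int[mu]_y f1 (x, y))%E =
    (((fun s => p s * \int[mu]_(u in `[0, s]) g u) \_ `[0, t]) x)%:E.
  rewrite /f1 /=; have [xt|xt] := boolP (x \in `[0, t]%classic); last first.
    rewrite patchE (negbTE xt) integral0_eq// => y _.
    by rewrite /p' patchE (negbTE xt) !mul0r.
  rewrite patchE xt.
  move: (xt); rewrite inE/= in_itv/= => x0t.
  have -> : (fun y => (p' x * g' y * \1_A (x, y))%:E) =
            (fun y => (p x * (g \_ `[0, x]) y)%:E).
    apply/funext => y; rewrite /p' patchE xt -mulrA; congr (_ * _)%:E.
    rewrite /g' !patchE indicE; case/andP: x0t => x0 xt'.
    have -> : ((x, y) \in A) = (y <= x) by apply/idP/idP; rewrite inE.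
    have -> : (y \in `[0, t]%classic) = (0 <= y <= t) by rewrite mem_setE in_itv.
    have -> : (y \in `[0, x]%classic) = (0 <= y <= x) by rewrite mem_setE in_itv.
    have [yx|yx] := leP y x; last by rewrite andbF mulr0.
    by rewrite (le_trans yx xt') !andbT mulr1.
  have xt' : `[0, x] `<=` `[0, t]%classic.
    by case/andP: x0t => _ xt'; apply: subset_itvl; rewrite bnd_simp.
  rewrite (integral_EFinZl _ (slice g gi _ (measurable_itv _) xt')).
  by rewrite -Rintegral_mkcond.
have F2 y : (\int[mu]_x f2 (x, y))%E =
    (((fun s => g s * \int[mu]_(u in `[0, s]) p u) \_ `[0, t]) y)%:E.
  rewrite /f2 /=; have [yt|yt] := boolP (y \in `[0, t]%classic); last first.
    rewrite patchE (negbTE yt) integral0_eq// => x _.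
    by rewrite /g' patchE (negbTE yt) mulr0 mul0r.
  rewrite patchE yt.
  move: (yt); rewrite inE/= in_itv/= => y0t.
  have -> : (fun x => (p' x * g' y * \1_(~` A) (x, y))%:E) =
            (fun x => (g y * (p \_ `[0, y[) x)%:E).
    apply/funext => x; rewrite /g' patchE yt (mulrC (p' x)) -mulrA; congr (_ * _)%:E.
    rewrite /p' !patchE indicE; case/andP: y0t => y0 yt'.
    have -> : ((x, y) \in ~` A) = (x < y).
      by rewrite in_setC ltNge; congr (~~ _); apply/idP/idP; rewrite inE.
    have -> : (x \in `[0, t]%classic) = (0 <= x <= t) by rewrite mem_setE in_itv.
    have -> : (x \in `[0, y[%classic) = (0 <= x < y) by rewrite mem_setE in_itv.
    have [xy|xy] := ltP x y; last by rewrite andbF mulr0.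
    by rewrite (le_trans (ltW xy) yt') !andbT mulr1.
  have yt' : `[0, y] `<=` `[0, t]%classic.
    by case/andP: y0t => _ yt'; apply: subset_itvl; rewrite bnd_simp.
  have yt'' : `[0, y[ `<=` `[0, t]%classic.
    by apply: subset_trans yt'; apply: subset_itvl; rewrite bnd_simp.
  rewrite (integral_EFinZl _ (slice p pi_ _ (measurable_itv _) yt'')).
  by rewrite -Rintegral_mkcond Rintegral_itv_bndo_bndc//; exact: integrableS pi_.
have F1i : mu.-integrable [set: R] (EFin \o
    ((fun s => p s * \int[mu]_(u in `[0, s]) g u) \_ `[0, t])).
  by apply: eq_integrable (integrable_fubini_F f1i) => // x _; exact: F1.
(* [integrable_fubini_F] integrates out the second coordinate, whereas the sections of [f2] run over
   the first. So p and g exchange their roles, and [A'] is the mirror image of the complement of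
   [A]. *)
pose A' : set RR := [set z | z.2 < z.1].
have mA' : measurable A'.
  have := measurable_fun_ltr (measurable_snd : measurable_fun [set: RR] snd)
    (measurable_fst : measurable_fun [set: RR] fst).
  move=> /(_ measurableT [set true] I); rewrite setTI.
  by congr measurable; apply/seteqP; split => z.
have F2i : mu.-integrable [set: R] (EFin \o
    ((fun s => g s * \int[mu]_(u in `[0, s]) p u) \_ `[0, t])).
  apply: eq_integrable (integrable_fubini_F (integrable_tensor g'i p'i mA')) => //.
  move=> y _; apply: etrans (F2 y); apply: eq_integral => x _.
  rewrite /f2/= [g' y * _]mulrC.
  congr (_ * _)%:E; rewrite !indicE in_setC; congr (nat_of_bool _)%:R.
  have -> : ((x, y) \in A) = (y <= x) by apply/idP/idP; rewrite inE.
  by rewrite -ltNge; apply/idP/idP; rewrite inE.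
have unrestrict (k : R -> R) : mu.-integrable [set: R] (EFin \o (k \_ `[0, t])) ->
    mu.-integrable `[0, t] (EFin \o k).
  by rewrite -restrict_EFin -integrable_mkcond.
split; [exact: unrestrict F1i|exact: unrestrict F2i|].
have out (k : R -> R) : mu.-integrable [set: R] (EFin \o (k \_ `[0, t])) ->
    (\int[mu]_x ((k \_ `[0, t]) x)%:E = (\int[mu]_(x in `[0, t]) k x)%:E)%E.
  by move=> ki; rewrite EFin_Rintegral// -Rintegral_mkcond.
apply: EFin_inj; rewrite -IH f12 EFinD; congr (_ + _)%E.
  rewrite -integral12_prod_meas1//.
  by rewrite -(out _ F1i); apply: eq_integral => x _; rewrite -F1.
rewrite -integral21_prod_meas1//.
by rewrite -(out _ F2i); apply: eq_integral => x _; rewrite -F2.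
Qed.

(** Integration by parts, from [Rintegral_mul] with m = m 0 plus the primitive of p. It will be used
    with the money market value for m and the reinvested gains for G. *)
Lemma Rintegral_product_rule (m p g : R -> R) (t : R) : 0 <= t ->
  mu.-integrable `[0, t] (EFin \o p) -> mu.-integrable `[0, t] (EFin \o g) ->
  (forall s, 0 <= s <= t -> m s = m 0 + \int[mu]_(u in `[0, s]) p u) ->
  let G s := \int[mu]_(u in `[0, s]) g u in
  mu.-integrable `[0, t] (fun s => (m s * g s + G s * p s)%:E) /\
  \int[mu]_(s in `[0, t]) (m s * g s + G s * p s) = m t * G t.
Proof.
move=> t0 pi_ gi mE G.
have [i1 i2 E] := Rintegral_mul pi_ gi.
have i0 : mu.-integrable `[0, t] (fun s => (m 0 * g s)%:E).
  have : mu.-integrable `[0, t] (fun s => (m 0)%:E * (g s)%:E)%E by exact: integrableZl.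
  by apply: eq_integrable.
have i02 : mu.-integrable `[0, t]
    (fun s => (m 0 * g s + g s * \int[mu]_(u in `[0, s]) p u)%:E).
  have := integrableD _ i0 i2; move=> /(_ (measurable_itv _)); exact: eq_integrable.
have sumE : {in `[0, t]%classic, (fun s => m s * g s + G s * p s) =1
    (fun s => (m 0 * g s + g s * \int[mu]_(u in `[0, s]) p u) +
      p s * \int[mu]_(u in `[0, s]) g u)}.
  by move=> s; rewrite inE/= in_itv/= => st; rewrite (mE s st) /G; ring.
split.
  have := integrableD _ i02 i1; move=> /(_ (measurable_itv _)).
  by apply: eq_integrable => // s st; rewrite sumE.
transitivity (\int[mu]_(s in `[0, t])
    ((m 0 * g s + g s * \int[mu]_(u in `[0, s]) p u) +
      p s * \int[mu]_(u in `[0, s]) g u)); first exact: eq_Rintegral.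
rewrite RintegralD// RintegralD// RintegralZl//.
have t0t : 0 <= t <= t by rewrite t0 lexx.
rewrite (mE t t0t) mulrDl /G E -addrA; congr (_ + _).
exact: addrC.
Qed.

End ProductRule.

(** * Conditional expectation of a bounded nonnegative variable *)

Section ConditionalExpectation.
Local Open Scope ereal_scope.
Context (R : realType) (d d' : measure_display) (Omega : measurableType d).
Context (Omega' : measurableType d') (P : probability Omega R).
Context (phi : Omega -> Omega').
Hypothesis mphi : measurable_fun [set: Omega] phi.
Context (A : Omega -> R) (c : R).
Hypothesis mA : measurable_fun [set: Omega] A.
Hypothesis A0 : forall w, (0 <= A w)%R.
Hypothesis Ac : forall w, (A w <= c)%R.

HB.instance Definition _ := isMeasurableFun.Build _ _ _ _ phi mphi.

Let nu (C : set Omega) := \int[P]_(w in C) (A w)%:E.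

Let mAE : measurable_fun [set: Omega] (EFin \o A).
Proof. exact/measurable_EFinP. Qed.

Let nu0 : nu set0 = 0. Proof. exact: integral_set0. Qed.
Let nu_ge0 C : 0 <= nu C.
Proof. by apply: integral_ge0 => w _; rewrite lee_fin. Qed.
Let nu_sigma : semi_sigma_additive nu.
Proof. by apply: semi_sigma_additive_nng_induced => // w; rewrite lee_fin. Qed.

HB.instance Definition _ := isMeasure.Build _ _ _ nu nu0 nu_ge0 nu_sigma.

Let iA : P.-integrable [set: Omega] (EFin \o A).
Proof.
apply: (@le_integrable _ _ _ _ _ _ _ (cst c%:E)) => //.
- move=> w _ /=; rewrite lee_fin ger0_norm// (le_trans (Ac w))//.
  exact: ler_norm.
- exact: finite_measure_integrable_cst.
Qed.

Let nu_fin : fin_num_fun nu.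
Proof.
by move=> C mC; apply: integrable_fin_num => //; exact: integrableS iA.
Qed.

HB.instance Definition _ := @Measure_isFinite.Build _ _ _ nu nu_fin.

Let Q : probability Omega' R := distribution P phi.

Let nuQ : set Omega' -> \bar R := pushforward nu phi.

Let mpre (C : set Omega') : measurable C -> measurable (phi @^-1` C).
Proof. by move=> mC; rewrite -[X in measurable X]setTI; exact: mphi. Qed.

Let nuQ0 : nuQ set0 = 0. Proof. by rewrite /nuQ /pushforward preimage_set0. Qed.
Let nuQ_ge0 C : 0 <= nuQ C. Proof. exact: nu_ge0. Qed.
Let nuQ_sigma : semi_sigma_additive nuQ.
Proof.
move=> G mG tG mUG; rewrite /nuQ /pushforward preimage_bigcup.
apply: nu_sigma => [n||]; first exact: mpre.
- apply/trivIsetP => i j _ _ ij; rewrite -preimage_setI.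
  by move/trivIsetP: tG => /(_ i j I I ij) ->; rewrite preimage_set0.
- by rewrite -preimage_bigcup; exact: mpre.
Qed.

HB.instance Definition _ := isMeasure.Build _ _ _ nuQ nuQ0 nuQ_ge0 nuQ_sigma.

Let nuQ_fin : fin_num_fun nuQ.
Proof.
by move=> C mC; apply: nu_fin; exact: mpre.
Qed.
HB.instance Definition _ := @Measure_isFinite.Build _ _ _ nuQ nuQ_fin.

Lemma conditional_expectation_exists : exists B : Omega' -> R,
  [/\ measurable_fun [set: Omega'] B, (forall w, 0 <= B w)%R &
    forall Y : Omega' -> R, measurable_fun [set: Omega'] Y -> (forall w, 0 <= Y w)%R ->
      \int[P]_w (A w * Y (phi w))%:E = \int[P]_w (B (phi w) * Y (phi w))%:E].
Proof.
have dom : nuQ `<< Q.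
  apply/null_content_dominatesP => C mC QC0.
  apply: null_set_integral => //; last exact: measurable_funTS.
  exact: mpre.
pose f := Radon_Nikodym_SigmaFinite.f nuQ Q.
have fi : Q.-integrable [set: Omega'] f by exact: Radon_Nikodym_SigmaFinite.f_integrable.
have ffin w : f w \is a fin_num by exact: Radon_Nikodym_SigmaFinite.f_fin_num.
have f0 w : 0 <= f w by exact: Radon_Nikodym_SigmaFinite.f_ge0.
have mf : measurable_fun [set: Omega'] (fine \o f).
  by apply: measurableT_comp => //; exact: measurable_int fi.
exists (fine \o f); split=> //.
  by move=> w /=; rewrite fine_ge0.
move=> Y mY Y0.
have mYE : measurable_fun [set: Omega'] (EFin \o Y) by exact/measurable_EFinP.
transitivity (\int[nu]_w (Y (phi w))%:E).
  rewrite [RHS](ge0_integral_density (m := P) (k := EFin \o A))//.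
  - by apply: eq_integral => w _; rewrite mulrC EFinM.
  - by apply/measurable_EFinP; exact: measurableT_comp.
  - by move=> w; rewrite lee_fin.
transitivity (\int[nuQ]_y (Y y)%:E).
  by rewrite /nuQ ge0_integral_pushforward// => y _; rewrite lee_fin.
rewrite [LHS](ge0_integral_density (m := Q) (k := f))//; last first.
  by move=> C mC; exact: Radon_Nikodym_SigmaFinite.f_integral.
rewrite /Q ge0_integral_distribution//; last 2 first.
- by apply: emeasurable_funM => //; exact: measurable_int fi.
- by move=> y; rewrite mule_ge0// lee_fin.
by apply: eq_integral => w _; rewrite /= EFinM fineK// muleC.
Qed.

End ConditionalExpectation.

(** * The time integral of a process with values in [0, 1], at a fixed time *)

Section AdaptedIntegral.
Context (R : realType) (d : measure_display) (Omega : measurableType d).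
Context (P : probability Omega R) (h : \bar R).
Context (F : R -> set (set Omega)) (hF : filtration h F).
Local Notation mu := (@lebesgue_measure R).
Context (g : R -> Omega -> R) (ga : adapted_measurable_fun h F g).
Hypothesis g0 : forall t w, 0 <= g t w.
Hypothesis g1 : forall t w, g t w <= 1.

Let A t w := \int[mu]_(s in `[0, t]) g s w.

Lemma integrable_bounded_path t w : time_set h t ->
  mu.-integrable `[0, t] (fun s => (g s w)%:E).
Proof.
move=> Tt; have [_ mg] := ga.
have mgw : measurable_fun `[0, t] (fun s => g s w).
  apply: measurable_funS (sub_itv_time_set Tt) _; first exact: measurable_time_set.
  exact: (measurable_fun_xsection_domain (f := fun z => g z.2 z.1) w
    (measurable_time_set h) mg).
apply: (@le_integrable _ _ _ _ _ _ _ (cst 1%E)) => //.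
- exact/measurable_EFinP.
- by move=> s _ /=; rewrite lee_fin normr1 ger0_norm.
- exact: integrable_cst_itv.
Qed.

Lemma path_integral_ge0 t w : 0 <= A t w.
Proof. by apply: Rintegral_ge0 => s _. Qed.

(** Because 0 <= g <= 1. Monotonicity and continuity will recover A(t) from its values at earlier
    rational times. *)
Lemma path_integral_lipschitz s t w : time_set h s -> time_set h t -> s <= t ->
  A s w <= A t w <= A s w + (t - s).
Proof.
move=> Ts Tt st.
have s0 : 0 <= s by case: Ts.
have it := integrable_bounded_path w Tt.
have split_ : `[0, t]%classic = `[0, s] `|` `]s, t].
  by rewrite -itv_bndbnd_setU// bnd_simp.
have ist : mu.-integrable `]s, t] (fun u => (g u w)%:E).
  apply: integrableS it => //; rewrite split_; exact: subsetUr.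
have -> : A t w = A s w + \int[mu]_(u in `]s, t]) g u w.
  rewrite /A split_ Rintegral_setU// -?split_//.
  apply/disj_setPS => u [] /=; rewrite !in_itv/= => /andP[_ us] /andP[su _].
  by move: (lt_le_trans su us); rewrite ltxx.
rewrite lerDl Rintegral_ge0//= lerD2l.
apply: (@le_trans _ _ (\int[mu]_(u in `]s, t]) 1)).
  apply: le_Rintegral => //.
  exact: integrable_cst_itv.
rewrite Rintegral_cst// mul1r [X in fine X]lebesgue_measure_itv/= lte_fin.
by case: ltP => // le; rewrite /= subr_ge0.
Qed.

(** Extension by 0 makes the integrand jointly measurable on the whole product, as needed for
    Tonelli's theorem. *)
Let G t (z : Omega * R) : R := ((fun z => g z.2 z.1) \_ (setT `*` `[0, t])) z.

Let mG t : time_set h t ->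
  measurable_fun [set: (Omega * measurableTypeR R)%type] (G t).
Proof.
move=> Tt; have [_ mg] := ga.
have mD : measurable ([set: Omega] `*` (`[0, t]%classic : set R)).
  exact: measurableX.
apply/(measurable_restrictT _ mD).
apply: measurable_funS mg; first exact: measurable_domain.
by move=> z [_ zt]; split => //; exact: sub_itv_time_set zt.
Qed.

Let GE t w s : G t (w, s) = if s \in `[0, t]%classic then g s w else 0.
Proof.
rewrite /G patchE; congr (if _ then _ else _).
by apply/idP/idP; rewrite !inE => //= -[].
Qed.

Let AE t w : time_set h t -> (\int[mu]_s (G t (w, s))%:E = (A t w)%:E)%E.
Proof.
move=> Tt; rewrite -EFin_Rintegral//; last exact: integrable_bounded_path.
rewrite [RHS]integral_mkcond; apply: eq_integral => s _.
by rewrite GE patchE; case: ifP.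
Qed.

Lemma measurable_path_integral t : time_set h t ->
  measurable_fun [set: Omega] (A t).
Proof.
move=> Tt; apply/measurable_EFinP.
have mGE : measurable_fun [set: (Omega * measurableTypeR R)%type] (EFin \o G t).
  by apply/measurable_EFinP; exact: mG.
have := @measurable_fun_fubini_tonelli_F _ _ _ _ _ mu _ mGE.
rewrite (_ : fubini_F _ _ = EFin \o A t); last by apply/funext => w; rewrite /fubini_F /= AE.
by apply => z; rewrite lee_fin /G patchE; case: ifP.
Qed.

(* Since [g s] is F_t-measurable for [s <= t], Tonelli's theorem gives
   E[A(t)^2] = E[A(t) B] = E[B^2] for the conditional expectation B of A(t). *)
Lemma path_integral_ae_adapted t : time_set h t -> exists B : Omega -> R,
  measurable_fun [set: g_sigma_algebraType (F t)]
    (B : g_sigma_algebraType (F t) -> R) /\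
  {ae P, forall w, A t w = B w}.
Proof.
move=> Tt.
have mA := measurable_path_integral Tt.
have At w : A t w <= t.
  have T0 : time_set h 0 by case: (Tt) => t0 _; exact: time_set_sub (lexx 0) t0 Tt.
  have [t0 _] := Tt.
  have /andP[_] := path_integral_lipschitz w T0 Tt t0.
  rewrite subr0 => /le_trans; apply; rewrite -[leRHS]add0r lerD2r /A.
  by rewrite set_itv1 Rintegral_set1.
have [B [mB B0 EB]] := conditional_expectation_exists P
  (filtration_measurable hF Tt) mA (path_integral_ge0 t) At.
exists B; split=> //.
have mBO : measurable_fun [set: Omega] B := filtration_measurable_fun hF Tt mB.
have ton (Y : Omega -> R) : measurable_fun [set: Omega] Y -> (forall w, 0 <= Y w) ->
    (\int[P]_w (A t w * Y w)%:E = \int[mu]_s \int[P]_w (G t (w, s) * Y w)%:E)%E.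
  move=> mY Y0.
  have mGY : measurable_fun [set: (Omega * measurableTypeR R)%type]
      (fun z => (G t z * Y z.1)%:E).
    apply/measurable_EFinP; apply: measurable_funM; first exact: mG.
    exact: measurableT_comp.
  have GY0 z : (0 <= (G t z * Y z.1)%:E)%E.
    by rewrite lee_fin mulr_ge0// /G patchE; case: ifP.
  rewrite -(@fubini_tonelli _ _ _ _ _ P mu _ mGY GY0).
  apply: eq_integral => w _; rewrite mulrC EFinM -AE// -ge0_integralZl//.
  - by apply: eq_integral => s _; rewrite /= mulrC EFinM.
  - apply/measurable_EFinP.
    have := mG Tt; rewrite -setXTT => mGt.
    exact: (measurable_fun_xsection_domain w measurableT mGt).
  - by move=> s _; rewrite lee_fin GE; case: ifP.
  - by rewrite lee_fin.
have EAA : (\int[P]_w (A t w * A t w)%:E = \int[P]_w (A t w * B w)%:E)%E.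
  rewrite (ton _ mA (path_integral_ge0 t)) (ton _ mBO B0).
  apply: eq_integral => s _.
  have [st|/negbTE st] := boolP (s \in `[0, t]%classic); last first.
    by apply: eq_integral => w _; rewrite GE st !mul0r.
  under eq_integral do rewrite GE st mulrC.
  under [RHS]eq_integral do rewrite GE st mulrC.
  move: st; rewrite inE/= in_itv/= => /andP[s0 st].
  have Ts : time_set h s by exact: time_set_sub s0 st Tt.
  apply: EB => //; apply: (filtration_mono_measurable_fun hF Ts Tt st).
  by have [+ _] := ga; apply.
have EAB : (\int[P]_w (A t w * B w)%:E = \int[P]_w (B w * B w)%:E)%E.
  exact: EB.
have fAB : (\int[P]_w (A t w * B w)%:E \is a fin_num)%E.
  rewrite -EAA ge0_fin_numE ?integral_ge0//; last first.
    by move=> w _; rewrite lee_fin mulr_ge0 ?path_integral_ge0.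
  apply: (@le_lt_trans _ _ (\int[P]_w (cst (t * t)%:E w))%E).
    apply: ge0_le_integral => //.
    - by move=> w _; rewrite lee_fin mulr_ge0 ?path_integral_ge0.
    - by apply/measurable_EFinP; exact: measurable_funM.
    - by move=> w _; rewrite lee_fin ler_pM ?path_integral_ge0.
  by rewrite integral_cst//= [X in (_ * X)%E](@probability_setT _ _ _ P) mule1 ltry.
have mdiff : measurable_fun [set: Omega] (fun w => (A t w - B w) ^+ 2).
  by apply: (measurable_funX 2); exact: measurable_funB.
have sq0 : (\int[P]_w ((A t w - B w) ^+ 2)%:E = 0)%E.
  have AB0 w : 0 <= A t w * B w by rewrite mulr_ge0 ?path_integral_ge0.
  have mAB : measurable_fun [set: Omega] (fun w => (A t w * B w)%:E).
    by apply/measurable_EFinP; exact: measurable_funM.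
  have mAA : measurable_fun [set: Omega] (fun w => (A t w * A t w)%:E).
    by apply/measurable_EFinP; exact: measurable_funM.
  have mBB : measurable_fun [set: Omega] (fun w => (B w * B w)%:E).
    by apply/measurable_EFinP; exact: measurable_funM.
  (* Expectations are extended reals, so the square is expanded without subtraction; finiteness of
     E[A(t) B] then permits cancelling. *)
  have : (\int[P]_w ((A t w - B w) ^+ 2)%:E +
      (\int[P]_w (A t w * B w)%:E + \int[P]_w (A t w * B w)%:E) =
      \int[P]_w (A t w * A t w)%:E + \int[P]_w (B w * B w)%:E)%E.
    rewrite -!ge0_integralD//.
    - by apply: eq_integral => w _; rewrite -!EFinD; congr EFin; ring.
    - by move=> w _; rewrite lee_fin mulr_ge0 ?path_integral_ge0.
    - by move=> w _; rewrite lee_fin mulr_ge0.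
    - by move=> w _; rewrite lee_fin sqr_ge0.
    - exact/measurable_EFinP.
    - by move=> w _; rewrite -EFinD lee_fin addr_ge0.
    - exact: emeasurable_funD.
    - by move=> w _; rewrite lee_fin.
    - by move=> w _; rewrite lee_fin.
  have : (0 <= \int[P]_w ((A t w - B w) ^+ 2)%:E)%E.
    by apply: integral_ge0 => w _; rewrite lee_fin sqr_ge0.
  rewrite EAA -EAB; move: fAB; case: (\int[P]_w (A t w * B w)%:E)%E => // a _.
  case: (\int[P]_w _)%E => //= x _ [xa]; congr EFin; lra.
move: sq0; rewrite -(@eq_integral _ _ _ P setT _
  (fun w => `|((A t w - B w) ^+ 2)%:E|%E)); last first.
  by move=> w _; rewrite gee0_abs// lee_fin sqr_ge0.
move=> /ae_eq_integral_abs => /(_ measurableT).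
move=> /(_ (proj2 (measurable_EFinP _ _) mdiff)); apply: filterS => w /(_ I)[] /eqP.
by rewrite sqrf_eq0 subr_eq0 => /eqP.
Qed.

End AdaptedIntegral.

(** * A version adapted at all times simultaneously *)

Section AdaptedVersion.
Context (R : realType) (d : measure_display) (Omega : measurableType d).
Context (P : probability Omega R) (h : \bar R).
Context (F : R -> set (set Omega)) (hF : filtration h F).
Local Notation mu := (@lebesgue_measure R).
Context (g : R -> Omega -> R) (ga : adapted_measurable_fun h F g).
Hypothesis g0 : forall t w, 0 <= g t w.
Hypothesis g1 : forall t w, g t w <= 1.

Let A t w := \int[mu]_(s in `[0, t]) g s w.

(** Choosing a version at every t separately would give neither joint measurability nor a common
    null set. [A'] is the supremum of the versions at rational times before t: each is
    F_t-measurable, only countably many null sets are discarded, and A, being nonnegative,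
    nondecreasing, continuous and null at 0, is recovered at every t. *)
Lemma path_integral_adapted_version : exists A' : R -> Omega -> R,
  adapted_measurable_fun h F A' /\ almost_surely P h (fun t w => A' t w = A t w).
Proof.
have [B BP] : exists B : rat -> Omega -> R, forall q, time_set h (ratr q) ->
    measurable_fun [set: g_sigma_algebraType (F (ratr q))]
      (B q : g_sigma_algebraType (F (ratr q)) -> R) /\
    {ae P, forall w, A (ratr q) w = B q w}.
  suff /choice[B BP] : forall q : rat, exists B : Omega -> R, time_set h (ratr q) ->
    measurable_fun [set: g_sigma_algebraType (F (ratr q))]
      (B : g_sigma_algebraType (F (ratr q)) -> R) /\
    {ae P, forall w, A (ratr q) w = B w} by exists B.
  move=> q; have [Tq|nTq] := pselect (time_set h (ratr q)); last by exists (fun=> 0).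
  by have [B HB] := path_integral_ae_adapted P hF ga g0 g1 Tq; exists B.
(* Codes of no rational, rationals outside the time interval and rationals from t on contribute 0,
   which is harmless as A >= 0. *)
pose c (n : nat) (t : R) (w : Omega) : R := if unpickle n is Some q then
  if `[<time_set h (ratr q)>] && (ratr q < t) then B q w else 0 else 0.
(* The supremum can be infinite only on the discarded null set; there [fine] supplies a real value
   and keeps measurability. *)
pose A' (t : R) (w : Omega) : R := fine (esups (fun n => (c n t w)%:E) 0%N).
exists A'; split.
  split => [t Tt|].
    apply: measurableT_comp => //.
    apply: (measurable_fun_esups
      (f := fun n (w : g_sigma_algebraType (F t)) => (c n t w)%:E)) => n.
    apply/measurable_EFinP; rewrite /c; case: (unpickle n) => [q|//].
    have [Tq|nTq] := pselect (time_set h (ratr q)); last by rewrite asboolF.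
    rewrite (asboolT Tq) /=; case: (boolP (ratr q < t)) => // qt.
    apply: (filtration_mono_measurable_fun hF Tq Tt (ltW qt)).
    by have [] := BP q Tq.
  apply: measurableT_comp => //.
  apply: (measurable_fun_esups (f := fun n (z : Omega * R) => (c n z.2 z.1)%:E)) => n.
  apply/measurable_EFinP; rewrite /c; case: (unpickle n) => [q|//].
  have [Tq|nTq] := pselect (time_set h (ratr q)); last by rewrite asboolF.
  rewrite (asboolT Tq) /=.
  apply: measurable_fun_if => //.
  - exact: measurable_domain.
  - apply: measurable_fun_ltr => //.
    by apply: measurable_funTS; exact: measurable_snd.
  - apply: measurable_funS (_ : measurable_fun [set: Omega * R] (fun z => B q z.1)) => //.
    apply: (measurableT_comp _ measurable_fst).
    by apply: (filtration_measurable_fun hF Tq); have [] := BP q Tq.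
have : {ae P, forall w, forall q : rat, time_set h (ratr q) -> A (ratr q) w = B q w}.
  apply: ae_forall_rat => q; have [Tq|nTq] := pselect (time_set h (ratr q)).
    by have [_] := BP q Tq; apply: filterS => w AB _.
  by apply: aeW => w.
apply: filterS => w AB t Tt.
have A0 s : 0 <= A s w by exact: path_integral_ge0.
suff E : esups (fun n => (c n t w)%:E) 0%N = (A t w)%:E by rewrite /A' E.
have cle n : c n t w <= A t w.
  rewrite /c; case: (unpickle n) => [q|//].
  case: asboolP => [Tq|nTq] //=; case: ifPn => // qt.
  by rewrite -AB//; have /andP[] := path_integral_lipschitz ga g0 g1 w Tq Tt (ltW qt).
apply/eqP; rewrite eq_le; apply/andP; split.
  by apply: ge_ereal_sup => _ [n _ <-]; rewrite lee_fin.
have cge n : ((c n t w)%:E <= esups (fun n => (c n t w)%:E) 0%N)%E.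
  by apply: ereal_sup_ubound; exists n.
have [t0|t0] := leP t 0.
  have tE : t = 0 by apply/eqP; rewrite eq_le t0; case: Tt.
  have At0 : A t w = 0 by rewrite /A tE set_itv1 Rintegral_set1.
  rewrite At0; apply: le_trans (cge (pickle (0 : rat))).
  by rewrite /c pickleK rmorph0 tE ltxx andbF.
apply/lee_addgt0Pr => e e0.
have [|q] := @rat_in_itvoo R (Num.max 0 (t - e)) t.
  by rewrite gt_max t0/= ltrBlDr ltrDl.
rewrite in_itv/= gt_max => /andP[/andP[q0 qe] qt].
have Tq : time_set h (ratr q) by exact: time_set_sub (ltW q0) (ltW qt) Tt.
apply: (@le_trans _ _ ((c (pickle q) t w)%:E + e%:E)%E); last exact: leeD2r.
rewrite /c pickleK asboolT//= qt -AB// -EFinD lee_fin.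
have /andP[_] := path_integral_lipschitz ga g0 g1 w Tq Tt (ltW qt).
by rewrite -/(A t w) -/(A (ratr q) w) => /le_trans; apply; rewrite lerD2l; lra.
Qed.

End AdaptedVersion.

(** * Almost everywhere in outcome and time *)

Section AlmostEverywhereTime.
Context (R : realType) (d : measure_display) (Omega : measurableType d).
Context (P : probability Omega R) (h : \bar R) (F : R -> set (set Omega)).
Local Notation mu := (@lebesgue_measure R).
Local Notation PL := (P \x mu)%E.

Lemma ae_path_integral (x y : R -> R) t : measurable_fun (time_set h) x ->
  time_set h t -> {ae mu, forall s, time_set h s -> x s = y s} ->
  mu.-integrable `[0, t] (EFin \o y) ->
  mu.-integrable `[0, t] (EFin \o x) /\
  \int[mu]_(s in `[0, t]) x s = \int[mu]_(s in `[0, t]) y s.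
Proof.
move=> mx Tt xy yi.
have mxt : measurable_fun `[0, t] (EFin \o x).
  apply/measurable_EFinP; apply: measurable_funS (sub_itv_time_set Tt) mx.
  exact: measurable_time_set.
have myt := measurable_int _ yi.
have xyt : ae_eq mu `[0, t]%classic (EFin \o x : R -> \bar R) (EFin \o y : R -> \bar R).
  move: xy; apply: filterS; first exact: (ae_filter_ringOfSetsType mu).
  by move=> s xys st; rewrite /= xys//; exact: sub_itv_time_set st.
have xi : mu.-integrable `[0, t] (EFin \o x).
  apply/integrableP; split => //.
  have -> : (\int[mu]_(s in `[0%R, t]) `|(EFin \o x) s| =
             \int[mu]_(s in `[0%R, t]) `|(EFin \o y) s|)%E.
    apply: ae_eq_integral => //; [exact: measurableT_comp|exact: measurableT_comp|].
    exact: ae_eq_abse.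
  by have /integrableP[] := yi.
split=> //; congr fine; exact: ae_eq_integral.
Qed.

(** The exceptional set is covered by a null set times the whole line, of product measure 0 times
    +oo, which is 0. *)
Lemma almost_surely_ae_time (Q : R -> Omega -> Prop) :
  almost_surely P h Q -> almost_everywhere_time P h Q.
Proof.
move=> [N [mN N0 QN]]; exists (N `*` setT); split.
- exact: measurableX.
- transitivity (P N * mu setT)%E; first exact: product_measure1E.
  by rewrite N0 mul0e.
- by move=> [w t] /= nQ; split => //; apply: QN => QT; apply: nQ => Tt; exact: QT.
Qed.

Lemma measurable_time_eq x y : adapted_measurable_fun h F x ->
  adapted_measurable_fun h F y ->
  measurable [set z : Omega * R | ~ (time_set h z.2 -> x z.2 z.1 = y z.2 z.1)].
Proof.
move=> [_ mx] [_ my].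
rewrite (_ : [set z | _] = ([set: Omega] `*` time_set h) `&`
    (fun z : Omega * R => x z.2 z.1 == y z.2 z.1) @^-1` [set false]).
  by apply: (measurable_fun_eqr mx my) => //; exact: measurable_domain.
apply/seteqP; split => -[w t] /=.
  by move=> /not_implyP[Tt /eqP/negbTE xy].
by move=> [[_ Tt] /negbT/eqP xy] /(_ Tt).
Qed.

Lemma measurable_time_gt0 x : adapted_measurable_fun h F x ->
  measurable [set z : Omega * R | time_set h z.2 /\ 0 < x z.2 z.1].
Proof.
move=> [_ mx].
rewrite (_ : [set z | _] = ([set: Omega] `*` time_set h) `&`
    (fun z : Omega * R => 0 < x z.2 z.1) @^-1` [set true]).
  have m0 : measurable_fun ([set: Omega] `*` time_set h) (fun _ : Omega * R => 0 : R).
    exact: measurable_cst.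
  by apply: (measurable_fun_ltr m0 mx) => //; exact: measurable_domain.
by apply/seteqP; split => -[w t] /=; [case|case=> -[_ ?]].
Qed.

Lemma ae_time_of_sections x y : adapted_measurable_fun h F x ->
  adapted_measurable_fun h F y ->
  {ae P, forall w, {ae mu, forall t, time_set h t -> x t w = y t w}} ->
  almost_everywhere_time P h (fun t w => x t w = y t w).
Proof.
move=> xa ya.
apply: (@ae_of_xsection _ _ _ _ _ P mu (fun w t => time_set h t -> x t w = y t w)).
exact: measurable_time_eq.
Qed.

(** Adaptedness makes the set measurable, and for a measurable set having positive measure is the
    same as not being negligible. *)
Lemma with_positive_measureP x : adapted_measurable_fun h F x ->
  with_positive_measure P h (fun t w => 0 < x t w) <->
  ~ almost_everywhere_time P h (fun t w => ~ 0 < x t w).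
Proof.
move=> xa; have mA := measurable_time_gt0 xa.
rewrite /with_positive_measure /almost_everywhere_time.
set A := [set z | _] in mA *.
have negE : PL.-negligible A <-> PL A = 0%E by exact: negligibleP.
have aeE : {ae PL, forall z : Omega * R, time_set h z.2 -> ~ 0 < x z.2 z.1} <->
    PL.-negligible A.
  rewrite /almost_everywhere /prop_near1 /nbhs /=.
  have -> : A = ~` [set z : Omega * R | time_set h z.2 -> ~ 0 < x z.2 z.1].
    apply/seteqP; split => z /=; first by move=> [Tz xz] /(_ Tz).
    by move=> /not_implyP[Tz /contrapT].
  by [].
split=> [A0 /aeE/negE A0'|nae]; first by rewrite A0' ltxx in A0.
rewrite lt_neqAle measure_ge0 andbT eq_sym.
by apply/eqP => /negE/aeE.
Qed.

End AlmostEverywhereTime.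

(** * Value and drift of the money market account *)

Section Market.
Context (R : realType) (d : measure_display) (Omega : measurableType d).
Context (P : probability Omega R) (hP : measure_is_complete P) (h : \bar R).
Context (F : R -> set (set Omega)) (hF : filtration h F).
Context (K : nat) (W : process R Omega K 1) (hW : wiener_process P h F W).
Context (N : nat) (S mu : process R Omega N.+1 1) (sigma : process R Omega N.+1 K).
Hypothesis Sa : adapted_measurable h F S.
Hypothesis mua : adapted_measurable h F mu.
Hypothesis sigmaa : adapted_measurable h F sigma.
Context (b : process R Omega 1 N.+1).
Hypothesis hb : money_market_account P h F W S mu sigma b.
Context (r : R -> Omega -> R).
Hypothesis hr : interest_rate P h F (value_process S b) r.
Local Notation lambda := (@lebesgue_measure R).

Let M := value_process S b.

Let ba : adapted_measurable h F b.
Proof. by have [[[]]] := hb. Qed.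

Let ra : adapted_measurable_fun h F r.
Proof.
have [[ra _] _] := hr; have := (adapted_measurableP hF _).1 ra 0 0.
by under eq_fun do under eq_fun do rewrite /scalar_process mxE eqxx mulr1n.
Qed.

Lemma adapted_value_process Delta : adapted_measurable h F Delta ->
  adapted_measurable_fun h F (value_process S Delta).
Proof. by move=> Da; have := (adapted_measurableP hF _).1 (adapted_mulp hF Da Sa) 0 0. Qed.

Lemma adapted_excess_drift : adapted_measurable h F (excess_drift S mu r).
Proof.
have -> : excess_drift S mu r = fun t w => mu t w + (- r t w) *: S t w.
  by apply/funext => t; apply/funext => w; rewrite scaleNr.
apply: adapted_add => //; apply: adapted_scale => //; exact: adaptedN.
Qed.

Lemma adapted_excess_return Delta : adapted_measurable h F Delta ->
  adapted_measurable_fun h F (excess_return S mu r Delta).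
Proof.
move=> Da.
by have := (adapted_measurableP hF _).1 (adapted_mulp hF Da adapted_excess_drift) 0 0.
Qed.

Lemma excess_returnE Delta t w : excess_return S mu r Delta t w =
  mulp Delta mu t w 0 0 - r t w * value_process S Delta t w.
Proof.
by rewrite /excess_return /value_process /mulp /excess_drift mulmxBr -scalemxAr !mxE.
Qed.

Lemma money_market_value : {ae P, forall w, forall t, time_set h t ->
  [/\ 0 < M t w, lambda.-integrable `[0, t] (fun s => (mulp b mu s w 0 0)%:E) &
      M t w = M 0 w + \int[lambda]_(s in `[0, t]) mulp b mu s w 0 0]}.
Proof.
have [[[_ [_ bmui] [bsa _]] [I itoI repI]] Mpos [_ bs0]] := hb.
have I0 := ito_integral_null hP hF hW bsa itoI bs0.
move: repI; apply: filter_app; move: bmui I0 Mpos.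
apply: filterS3 => w bmu_w I0w Mw repw t Tt.
split; [exact: Mw|exact: bmu_w t Tt 0 0|].
have := congr1 (fun A : 'M[R]_1 => A 0 0) (repw t Tt).
rewrite I0w// addr0 => E; rewrite /M /value_process [LHS]E mxE.
by congr (_ + _); rewrite /time_integral mxE.
Qed.

(** The differential equation is solved path by path; joint measurability of both sides turns the
    result into an almost everywhere statement on the product. *)
Lemma money_market_drift :
  almost_everywhere_time P h (fun t w => mulp b mu t w 0 0 = r t w * M t w).
Proof.
apply: (@ae_time_of_sections _ _ _ P h F (fun t w => mulp b mu t w 0 0)
  (fun t w => r t w * M t w)).
- by have := (adapted_measurableP hF _).1 (adapted_mulp hF ba mua) 0 0.
- by apply: adaptedM => //; exact: adapted_value_process.
have [[_ ri] rM] := hr.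
move: ri rM money_market_value; apply: filterS3 => w ri rM Mw.
apply: ae_exponential_ode.
- move=> t Tt; have := ri t Tt 0 0; apply: eq_integrable => //.
  by move=> s _; rewrite /scalar_process /= mxE eqxx mulr1n.
- by move=> t Tt; have [] := Mw t Tt.
- move=> t Tt; rewrite /M rM// /time_integral mxE; congr (_ * expR _).
  by apply: eq_Rintegral => s _; rewrite /scalar_process /= mxE eqxx mulr1n.
- by move=> t Tt; have [] := Mw t Tt.
Qed.

End Market.

#[local] Instance ae_time_filter (R : realType) (d : measure_display)
    (Omega : measurableType d) (P : probability Omega R) :
  Filter (nbhs (almost_everywhere (P \x (@lebesgue_measure R))%E)).
Proof. exact: ae_filter_ringOfSetsType. Qed.

(** * The hedged strategy, a zero-value arbitrage *)

Section Arbitrage.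
Context (R : realType) (d : measure_display) (Omega : measurableType d).
Context (P : probability Omega R) (hP : measure_is_complete P) (h : \bar R).
Context (F : R -> set (set Omega)) (hF : filtration h F).
Context (K : nat) (W : process R Omega K 1) (hW : wiener_process P h F W).
Context (N : nat) (S mu : process R Omega N.+1 1) (sigma : process R Omega N.+1 K).
Hypothesis Sa : adapted_measurable h F S.
Hypothesis mua : adapted_measurable h F mu.
Hypothesis sigmaa : adapted_measurable h F sigma.
Context (b : process R Omega 1 N.+1).
Hypothesis hb : money_market_account P h F W S mu sigma b.
Context (r : R -> Omega -> R).
Hypothesis hr : interest_rate P h F (value_process S b) r.
Local Notation lambda := (@lebesgue_measure R).
Local Notation M := (value_process S b).
Context (Delta : process R Omega 1 N.+1).
Hypothesis riskless : instantaneously_riskless P h F sigma Delta.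

Let Da : adapted_measurable h F Delta. Proof. by have [] := riskless. Qed.
Let ba : adapted_measurable h F b. Proof. by have [[[]]] := hb. Qed.

Local Notation V := (value_process S Delta).
Local Notation e := (excess_return S mu r Delta).

Definition excess_scale t w := M t w * e t w / (M t w ^+ 2 + e t w ^+ 2).

Definition excess_fraction t w := e t w ^+ 2 / (M t w ^+ 2 + e t w ^+ 2).

(* The money market position cancels the value of [Delta]; the scaling makes
   the drift equal to the money market value times a number in [0, 1]. *)
Definition hedged_strategy : process R Omega 1 N.+1 := fun t w =>
  excess_scale t w *: (Delta t w + (- (V t w / M t w)) *: b t w).

Lemma excess_fraction_ge0 t w : 0 <= excess_fraction t w.
Proof. by rewrite divr_ge0 ?addr_ge0 ?sqr_ge0. Qed.

Lemma excess_fraction_le1 t w : excess_fraction t w <= 1.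
Proof.
(* [M] is positive only almost surely. On the remaining paths the denominator may be 0; the quotient
   is then 0, so the bounds hold everywhere. *)
rewrite /excess_fraction; have [->|q0] := eqVneq (M t w ^+ 2 + e t w ^+ 2) 0.
  by rewrite invr0 mulr0.
have := sqr_ge0 (M t w); have := sqr_ge0 (e t w) => e2 M2.
by rewrite ler_pdivrMr ?mul1r ?lerDr// lt_neqAle eq_sym q0 addr_ge0.
Qed.

Lemma excess_fraction_eq0 t w : 0 < M t w -> excess_fraction t w = 0 -> e t w = 0.
Proof.
move=> M0 /eqP; rewrite mulf_eq0 invr_eq0 sqrf_eq0 => /orP[/eqP//|].
by rewrite gt_eqF// ltr_wpDr ?sqr_ge0// exprn_gt0.
Qed.

Let Ma : adapted_measurable_fun h F M := adapted_value_process hF Sa ba.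
Let Va : adapted_measurable_fun h F V := adapted_value_process hF Sa Da.
Let ea : adapted_measurable_fun h F e := adapted_excess_return hF Sa mua hr Da.

Let qa : adapted_measurable_fun h F
  (fun t w => (M t w ^+ 2 + e t w ^+ 2)^-1).
Proof.
apply: adaptedV => //; apply: adaptedD => //;
  by apply: (adapted_comp (f := fun x => x ^+ 2)) => //; exact: exprn_measurable.
Qed.

Lemma adapted_excess_fraction : adapted_measurable_fun h F excess_fraction.
Proof.
apply: adaptedM => //.
by apply: (adapted_comp (f := fun x => x ^+ 2)) => //; exact: exprn_measurable.
Qed.

Lemma adapted_hedged_strategy : adapted_measurable h F hedged_strategy.
Proof.
apply: adapted_scale => //; first by apply: adaptedM => //; exact: adaptedM.
apply: adapted_add => //; apply: adapted_scale => //; apply: adaptedN.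
by apply: adaptedM => //; exact: adaptedV.
Qed.

Lemma hedged_strategy_mul p (X : process R Omega N.+1 p) t w :
  mulp hedged_strategy X t w = excess_scale t w *:
    (mulp Delta X t w - (V t w / M t w) *: mulp b X t w).
Proof. by rewrite /mulp /hedged_strategy -scalemxAl mulmxDl -scalemxAl scaleNr. Qed.

Lemma hedged_strategy_mulE p (X : process R Omega N.+1 p) t w i j :
  mulp hedged_strategy X t w i j = excess_scale t w *
    (mulp Delta X t w i j - V t w / M t w * mulp b X t w i j).
Proof.
rewrite hedged_strategy_mul; move: (mulp Delta X t w) (mulp b X t w) => A B.
by rewrite !mxE.
Qed.

Lemma hedged_strategy_value t w : 0 < M t w ->
  value_process S hedged_strategy t w = 0.
Proof.
move=> M0; rewrite /value_process hedged_strategy_mulE -/(V t w) -/(M t w).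
by rewrite divfK ?gt_eqF// subrr mulr0.
Qed.

Lemma hedged_strategy_riskless : almost_everywhere_time P h
  (fun t w => mulp hedged_strategy sigma t w = 0).
Proof.
have [_ s0] := riskless; have [_ _ [_ bs0]] := hb.
move: s0 bs0; apply: filterS2 => -[w t] /= s0 bs0 Tt.
by rewrite hedged_strategy_mul s0// bs0// scaler0 subr0 scaler0.
Qed.

Lemma money_market_gt0 : almost_everywhere_time P h (fun t w => 0 < M t w).
Proof. by apply: almost_surely_ae_time; have [_ + _] := hb. Qed.

Lemma hedged_strategy_drift : almost_everywhere_time P h
  (fun t w => mulp hedged_strategy mu t w 0 0 = M t w * excess_fraction t w).
Proof.
have := money_market_drift hP hF hW Sa mua hb hr.
move: money_market_gt0; apply: filterS2 => -[w t] /= M0 bmu Tt.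
have {}M0 := M0 Tt; have {}bmu := bmu Tt.
rewrite hedged_strategy_mulE bmu.
have -> : mulp Delta mu t w 0 0 - V t w / M t w * (r t w * M t w) = e t w.
  by rewrite excess_returnE; field; rewrite gt_eqF.
by rewrite /excess_scale /excess_fraction; ring.
Qed.

Lemma hedged_strategy_arbitrage :
  ~ almost_everywhere_time P h (fun t w => e t w = 0) ->
  zero_value_instantaneous_arbitrage P h F S mu sigma hedged_strategy.
Proof.
move=> nae; split.
- by split; [exact: adapted_hedged_strategy|exact: hedged_strategy_riskless].
- move: money_market_gt0; apply: filterS => -[w t] /= M0 Tt.
  exact: hedged_strategy_value (M0 Tt).
- move: money_market_gt0 hedged_strategy_drift; apply: filterS2.
  move=> -[w t] /= M0 dE Tt.
  by rewrite dE// mulr_ge0 ?excess_fraction_ge0// ltW// M0.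
apply/(@with_positive_measureP _ _ _ P h F (fun t w => mulp hedged_strategy mu t w 0 0)).
  by have := (adapted_measurableP hF _).1 (adapted_mulp hF adapted_hedged_strategy mua) 0 0.
(* If the drift M g is almost nowhere positive, then g = 0 almost everywhere, and hence e = 0. *)
apply: contra_not nae.
move: money_market_gt0 hedged_strategy_drift; apply: filterS3.
move=> -[w t] /= M0 dE n0 Tt.
apply: (excess_fraction_eq0 (M0 Tt)); apply/eqP.
rewrite eq_le excess_fraction_ge0 andbT leNgt; apply/negP => g0.
by apply: (n0 Tt); rewrite dE// mulr_gt0// M0.
Qed.

End Arbitrage.

(** * The zero process as an Ito integral *)

Section ItoZero.
Context (R : realType) (d : measure_display) (Omega : measurableType d).
Context (P : probability Omega R) (hP : measure_is_complete P).
Context (h : \bar R) (h_gt0 : (0 < h)%E).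
Context (F : R -> set (set Omega)) (hF : filtration h F).
Context (K : nat) (W : process R Omega K 1).
Local Notation lambda := (@lebesgue_measure R).

Lemma time_set0 : time_set h 0.
Proof. by split => //; exact: ltW. Qed.

(** Even without intervals there is one grid point, which has to lie in the time interval; this uses
    [h_gt0]. *)
Definition zero_simple m : simple_process h F K m.
Proof.
refine (@SimpleProcess R d Omega h F K m 0 (fun=> 0) (fun _ _ => 0) _ _ _ _) => //.
- by move=> i _; exact: time_set0.
- by exists 0.
Defined.

(** Complements [ito_integral_null]: there every version of the integral vanishes, here the zero
    process is shown to be a version. It furnishes the Ito representation that self-financing asks
    for. *)
Lemma ito_integral_zero m (th : process R Omega m K) :
  adapted_measurable h F th ->
  almost_everywhere_time P h (fun t w => th t w = 0) ->
  ito_integral P h F W th (fun _ _ => 0).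
Proof.
move=> tha th0; split.
- move=> t i j B Tt mB.
  apply: ((measurable_fun_filtrationP hF (fun=> (0 : 'M[R]_(m, 1)) i j) Tt).1 _ B mB).
  exact: measurable_cst.
- by apply: aeW => w i j x; exact: cst_continuous.
exists (fun _ => zero_simple m) => t Tt; split.
  move=> i k eps eps0.
  have null (n : nat) : P [set w | (eps%:E <= \int[lambda]_(s in `[0%R, t])
      ((simple_value (zero_simple m) s w i k - th s w i k) ^+ 2)%:E)%E] = 0%E.
    rewrite -(measure0 P).
    apply: (proj2 (complete_ae_eq_set hP measurable0 _)).
    have := ae_time_section th0; apply: filterS => w thw /=.
    split => //; rewrite leNgt; move=> /negP; apply.
    rewrite (_ : integral _ _ _ = 0%E) ?lte_fin//.
    transitivity (\int[lambda]_(s in `[0%R, t]) (cst 0%E s))%E; last exact: integral0.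
    have msub : `[0, t] `<=` time_set h by exact: sub_itv_time_set.
    apply: ge0_ae_eq_integral => //.
    - apply/measurable_EFinP; apply: (measurable_funX 2); apply: measurable_funB.
        by apply: measurable_funTS; exact: measurable_simple_path.
      apply: measurable_funS msub _; first exact: measurable_time_set.
      exact: measurable_path tha.
    - by move=> s _; rewrite lee_fin sqr_ge0.
    move: thw; apply: filterS; first exact: (ae_filter_ringOfSetsType lambda).
    move=> s ths /msub/ths ->; rewrite /simple_value /= big_ord0 mxE subr0.
    by rewrite expr0n.
  by rewrite (_ : (fun n => P _) = cst 0%E); [exact: cvg_cst|exact/funext].
move=> i eps eps0.
have null (n : nat) : P [set w | (eps%:E <= `|simple_integral W (zero_simple m) t w i 0 -
    (0 : 'M[R]_(m, 1)) i 0|%:E)%E] = 0%E.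
  rewrite (_ : mkset _ = set0) ?measure0//; apply/seteqP; split => w //=.
  by rewrite /simple_integral /= big_ord0 mxE subr0 normr0 lee_fin leNgt eps0.
by rewrite (_ : (fun n => P _) = cst 0%E); [exact: cvg_cst|exact/funext].
Qed.

End ItoZero.

(** * Reinvesting the gains: a self-financing arbitrage *)

Section SelfFinancing.
Context (R : realType) (d : measure_display) (Omega : measurableType d).
Context (P : probability Omega R) (hP : measure_is_complete P) (h : \bar R).
Context (h_gt0 : (0 < h)%E).
Context (F : R -> set (set Omega)) (hF : filtration h F).
Context (K : nat) (W : process R Omega K 1) (hW : wiener_process P h F W).
Context (N : nat) (S mu : process R Omega N.+1 1) (sigma : process R Omega N.+1 K).
Hypothesis Sa : adapted_measurable h F S.
Hypothesis mua : adapted_measurable h F mu.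
Hypothesis sigmaa : adapted_measurable h F sigma.
Context (b : process R Omega 1 N.+1).
Hypothesis hb : money_market_account P h F W S mu sigma b.
Context (r : R -> Omega -> R).
Hypothesis hr : interest_rate P h F (value_process S b) r.
Local Notation lambda := (@lebesgue_measure R).
Local Notation M := (value_process S b).
Context (Delta : process R Omega 1 N.+1).
Hypothesis riskless : instantaneously_riskless P h F sigma Delta.

Let Da : adapted_measurable h F Delta. Proof. by have [] := riskless. Qed.
Let ba : adapted_measurable h F b. Proof. by have [[[]]] := hb. Qed.

Local Notation V := (value_process S Delta).
Local Notation e := (excess_return S mu r Delta).

Local Notation theta := (hedged_strategy S mu b r Delta).
Local Notation g := (excess_fraction S mu b r Delta).
Local Notation A := (fun t w => \int[lambda]_(s in `[0, t]) g s w).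

Let thetaa : adapted_measurable h F theta.
Proof. exact: (adapted_hedged_strategy hF Sa mua hb hr riskless). Qed.

Let ga : adapted_measurable_fun h F g.
Proof. exact: (adapted_excess_fraction hF Sa mua hb hr riskless). Qed.

Context (A' : R -> Omega -> R).
Hypothesis A'a : adapted_measurable_fun h F A'.
Hypothesis A'E : almost_surely P h (fun t w => A' t w = A t w).

Definition financed_strategy : process R Omega 1 N.+1 :=
  fun t w => theta t w + A' t w *: b t w.

Lemma adapted_financed_strategy : adapted_measurable h F financed_strategy.
Proof. by apply: adapted_add => //; exact: adapted_scale. Qed.

Lemma financed_strategy_mulE p (X : process R Omega N.+1 p) t w i j :
  mulp financed_strategy X t w i j = mulp theta X t w i j + A' t w * mulp b X t w i j.
Proof.
rewrite {1}/mulp /financed_strategy mulmxDl -scalemxAl -/(mulp theta X t w) -/(mulp b X t w).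
by move: (mulp theta X t w) (mulp b X t w) => B C; rewrite !mxE.
Qed.

Lemma financed_strategy_value t w : 0 < M t w ->
  value_process S financed_strategy t w = A' t w * M t w.
Proof.
move=> M0; rewrite /value_process financed_strategy_mulE.
by rewrite -/(value_process S theta t w) hedged_strategy_value// add0r.
Qed.

Lemma financed_strategy_riskless :
  instantaneously_riskless P h F sigma financed_strategy.
Proof.
split; first exact: adapted_financed_strategy.
have [_ _ [_ bs0]] := hb.
move: (hedged_strategy_riskless hb r riskless) bs0.
apply: filterS2 => -[w t] /= s0 bs0 Tt.
apply/matrixP => i j; rewrite financed_strategy_mulE s0// bs0// !mxE.
by rewrite mulr0 addr0.
Qed.

Lemma financed_strategy_drift : almost_everywhere_time P h (fun t w =>
  mulp financed_strategy mu t w 0 0 = M t w * g t w + A' t w * mulp b mu t w 0 0).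
Proof.
move: (hedged_strategy_drift hP hF hW Sa mua hb hr Delta); apply: filterS.
by move=> -[w t] /= dE Tt; rewrite financed_strategy_mulE dE.
Qed.

(** The money market position earns exactly the rate r, so its excess return A' (b mu - r M) is 0
    and only the drift of theta remains. *)
Lemma financed_strategy_excess : almost_everywhere_time P h (fun t w =>
  excess_return S mu r financed_strategy t w = M t w * g t w).
Proof.
move: (money_market_gt0 hb) financed_strategy_drift (money_market_drift hP hF hW Sa mua hb hr).
apply: filterS3 => -[w t] /= M0 dE bmu Tt.
rewrite excess_returnE dE// bmu// financed_strategy_value; last exact: M0.
ring.
Qed.

(** The product rule is applied to [M], whose density is b mu, and to A. The drift equals the
    resulting integrand only at almost all times, hence the transfer by [ae_path_integral]. *)
Lemma financed_strategy_path : {ae P, forall w, forall t, time_set h t ->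
  lambda.-integrable `[0, t] (fun s => (mulp financed_strategy mu s w 0 0)%:E) /\
  \int[lambda]_(s in `[0, t]) mulp financed_strategy mu s w 0 0 = M t w * A t w}.
Proof.
have Mpath := money_market_value hP hF hW hb.
move: (ae_time_section financed_strategy_drift) A'E Mpath.
apply: filterS3 => w dE A'Ew Mw t Tt.
have [_ bmui _] := Mw t Tt.
have gi := integrable_bounded_path ga (excess_fraction_ge0 S mu b r Delta)
  (excess_fraction_le1 S mu b r Delta) w Tt.
have t0 : 0 <= t by case: Tt.
have Ts s : 0 <= s <= t -> time_set h s.
  by move=> /andP[s0 st]; exact: time_set_sub s0 st Tt.
have [] := Rintegral_product_rule (m := M^~ w) t0 bmui gi.
  by move=> s /Ts Tss; have [] := Mw s Tss.
move=> yi <-; have ma := adapted_mulp hF adapted_financed_strategy mua.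
apply: (ae_path_integral (measurable_path 0 0 w ma) Tt _ yi).
move: dE; apply: filterS; first exact: (ae_filter_ringOfSetsType lambda).
by move=> s dE Tss; rewrite dE// A'Ew.
Qed.

Lemma calL2_null m n (X : process R Omega m n) : adapted_measurable h F X ->
  almost_everywhere_time P h (fun t w => X t w = 0) -> calL2 P h F X.
Proof.
move=> Xa X0; split=> //.
move: (ae_time_section X0); apply: filterS => w Xw t Tt i j.
have Xam : measurable_fun (time_set h) (fun s => X s w i j ^+ 2).
  by apply: (measurable_funX 2); exact: measurable_path Xa.
apply: (ae_path_integral (y := fun=> 0) Xam Tt _ (integrable_cst_itv _ _ _ _ _)).1.
move: Xw; apply: filterS; first exact: (ae_filter_ringOfSetsType lambda).
by move=> s Xs Tss; rewrite Xs// mxE expr0n.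
Qed.

Lemma financed_strategy_self_financing :
  self_financing P h F W S mu sigma financed_strategy.
Proof.
have fa := adapted_financed_strategy.
have [_ fs0] := financed_strategy_riskless.
have fsa := adapted_mulp hF fa sigmaa.
split; first split => //.
- split; first exact: adapted_mulp.
  move: financed_strategy_path; apply: filterS => w fw t Tt i j.
  by rewrite !ord1; have [] := fw t Tt.
- exact: calL2_null.
exists (fun _ _ => 0); first exact: (ito_integral_zero hP h_gt0 hF W fsa fs0).
have [_ Mpos _] := hb.
move: financed_strategy_path A'E Mpos; apply: filterS3 => w fw A'Ew M0 t Tt.
have T0 := time_set0 h_gt0.
have vE s : time_set h s -> mulp financed_strategy S s w 0 0 = A s w * M s w.
  by move=> Ts; have := financed_strategy_value (M0 s Ts); rewrite A'Ew.
apply/matrixP => i j; rewrite !ord1 addr0 [RHS]mxE [X in _ = _ + X]mxE vE// vE// (fw t Tt).2.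
(* The initial value A(0) M(0) is 0: the strategy starts without wealth. *)
by rewrite set_itv1 Rintegral_set1 mul0r add0r mulrC.
Qed.

(** In units of the money market account the drift is g, which lies in [0, 1]; this gives membership
    in [calL_G_invM] whatever the size of [Delta]. *)
Lemma financed_strategy_arbitrage :
  ~ almost_everywhere_time P h (fun t w => e t w = 0) ->
  instantaneous_arbitrage P h F S mu sigma M r financed_strategy.
Proof.
move=> nae; have fa := adapted_financed_strategy.
have [_ fs0] := financed_strategy_riskless.
have Ma := adapted_value_process hF Sa ba.
have eda := adapted_excess_drift hF Sa mua hr.
have MVa := adaptedV Ma.
split.
- exact: financed_strategy_riskless.
- have mulZ p (X : process R Omega N.+1 p) t w :
      mulp financed_strategy (fun t w => (M t w)^-1 *: X t w) t w =
      (M t w)^-1 *: mulp financed_strategy X t w by rewrite /mulp -scalemxAr.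
  split=> //.
    have Xa := adapted_mulp hF fa (adapted_scale hF MVa eda).
    split=> //.
    have [_ Mpos _] := hb.
    move: (ae_time_section financed_strategy_excess) Mpos.
    apply: filterS2 => w ew M0 t Tt i j; rewrite !ord1.
    have gi := integrable_bounded_path ga (excess_fraction_ge0 S mu b r Delta)
  (excess_fraction_le1 S mu b r Delta) w Tt.
    apply: (ae_path_integral (measurable_path 0 0 w Xa) Tt _ gi).1.
    move: ew; apply: filterS; first exact: (ae_filter_ringOfSetsType lambda).
    move=> s es Ts; rewrite mulZ mxE -/(excess_return S mu r financed_strategy s w).
    by rewrite es// mulKf// gt_eqF// M0.
  apply: (calL2_null (adapted_mulp hF fa (adapted_scale hF MVa sigmaa))).
  move: fs0; apply: filterS => -[w t] /= fs0 Tt.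
  by rewrite mulZ fs0// scaler0.
- move: financed_strategy_excess (money_market_gt0 hb); apply: filterS2.
  move=> -[w t] /= eE M0 Tt.
  by rewrite eE// mulr_ge0 ?excess_fraction_ge0// ltW// M0.
apply/(@with_positive_measureP _ _ _ P h F (excess_return S mu r financed_strategy)).
  exact: (adapted_excess_return hF Sa mua hr fa).
apply: contra_not nae.
move: financed_strategy_excess (money_market_gt0 hb); apply: filterS3.
move=> -[w t] /= eE M0 n0 Tt.
apply: (excess_fraction_eq0 (M0 Tt)); apply/eqP.
rewrite eq_le excess_fraction_ge0 andbT leNgt; apply/negP => g0.
by apply: (n0 Tt); rewrite eE// mulr_gt0// M0.
Qed.

End SelfFinancing.

Theorem proposition2 (R : realType) (d : measure_display)
    (Omega : measurableType d) (P : probability Omega R)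
    (hP : measure_is_complete P)
    (h : \bar R) (h_gt0 : (0 < h)%E)
    (F : R -> set (set Omega)) (hF : filtration h F)
    (K : nat) (W : process R Omega K 1) (hW : wiener_process P h F W)
    (N : nat) (S D mu : process R Omega N.+1 1)
    (sigma : process R Omega N.+1 K)
    (hmodel : securities_market_model P h F W S D mu sigma)
    (b : process R Omega 1 N.+1)
    (hb : money_market_account P h F W S mu sigma b)
    (r : R -> Omega -> R)
    (hr : interest_rate P h F (value_process S b) r)
    (hD : calL_invM P h F K (value_process S b) r D) :
  let M := value_process S b in
  let statement1 := instantaneously_arbitrage_free P h F S mu sigma in
  let statement2 := ~ exists Delta : process R Omega 1 N.+1,
    instantaneous_arbitrage P h F S mu sigma M r Delta in
  let statement3 := ~ exists Delta : process R Omega 1 N.+1,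
    self_financing P h F W S mu sigma Delta /\
    instantaneous_arbitrage P h F S mu sigma M r Delta in
  let statement4 := forall Delta : process R Omega 1 N.+1,
    instantaneously_riskless P h F sigma Delta ->
    almost_everywhere_time P h (fun t w => excess_return S mu r Delta t w = 0) in
  [/\ statement1 <-> statement2, statement2 <-> statement3
    & statement3 <-> statement4].
Proof.
have [Sa _ _ [mua _] [sigmaa _] _] := hmodel.
move=> M st1 st2 st3 st4.
(* Statement 4 is the hub. Statements 1 and 3 imply it by turning a nonzero excess return into an
   arbitrage; conversely it excludes both kinds of arbitrage. That 2 implies 3 is immediate. *)
have s14 : st1 -> st4.
  move=> s1 Delta riskless; apply: contrapT => nae; apply: s1.
  exists (hedged_strategy S mu b r Delta).
  exact: (hedged_strategy_arbitrage hP hF hW Sa mua hb hr riskless nae).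
have s34 : st3 -> st4.
  move=> s3 Delta riskless; apply: contrapT => nae; apply: s3.
  have ga := adapted_excess_fraction hF Sa mua hb hr riskless.
  have [A' [A'a A'E]] := path_integral_adapted_version P hF ga
    (excess_fraction_ge0 S mu b r Delta) (excess_fraction_le1 S mu b r Delta).
  exists (financed_strategy S mu b r Delta A'); split.
    exact: (financed_strategy_self_financing hP h_gt0 hF hW Sa mua sigmaa hb hr riskless A'a A'E).
  exact: (financed_strategy_arbitrage hP hF hW Sa mua sigmaa hb hr riskless A'a nae).
have s23 : st2 -> st3.
  by move=> s2 [Delta [_ arb]]; apply: s2; exists Delta.
have s42 : st4 -> st2.
  move=> s4 [Delta [riskless _ _]].
  move=> /(with_positive_measureP P (adapted_excess_return hF Sa mua hr (proj1 riskless))).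
  apply; move: (s4 _ riskless); apply: filterS => -[w t] /= e0 Tt.
  by rewrite e0// ltxx.
have s41 : st4 -> st1.
  move=> s4 [Delta [riskless v0 _]].
  have mua' := (adapted_measurableP hF _).1 (adapted_mulp hF (proj1 riskless) mua) 0 0.
  move=> /(with_positive_measureP P mua'); apply.
  (* At zero value the excess return is the drift itself, so statement 4 makes the drift 0 almost
     everywhere. *)
  move: (s4 _ riskless) v0; apply: filterS2 => -[w t] /= e0 v0 Tt.
  by have := e0 Tt; rewrite excess_returnE v0// mulr0 subr0 => ->; rewrite ltxx.
split; split.
- exact: (fun s1 => s42 (s14 s1)).
- exact: (fun s2 => s41 (s34 (s23 s2))).
- exact: s23.
- exact: (fun s3 => s42 (s34 s3)).
- exact: s34.
- exact: (fun s4 => s23 (s42 s4)).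
Qed.
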